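(* Let $(M,\tau,\ell,\mathfrak m)$ be a metric measure spacetime, $f_1,f_2:M\to\bar{\mathbb R}$ causal functions and $E\subset\mathbb R$ Borel and Lebesgue-negligible. Then $$|\mathrm df_1|=|\mathrm df_2|\qquad\mathfrak m\text{-a.e. on }(f_1-f_2)^{-1}(E).$$ In particular, $|\mathrm df_1|=|\mathrm df_2|$ $\mathfrak m$-a.e. on $\{f_1=f_2\}$, and $|\mathrm df_1|=0$ $\mathfrak m$-a.e. on $f_1^{-1}(E)\cap\mathrm{Vis}(M)$.
   Context: Conventions in $\bar{\mathbb R}=[-\infty,+\infty]$: $+\infty-(+\infty)=+\infty$, $-\infty-(-\infty)=+\infty$, $\pm\infty+z=\pm\infty$ for every $z\in\bar{\mathbb R}$, $0\cdot(\pm\infty)=0$. A time separation on a set $M$ is a map $\ell:M\times M\to\{-\infty\}\cup[0,+\infty]$ with $\ell(x,x)=0$ and $\min\{\ell(x,y)+\ell(y,z),\ell(y,z)+\ell(x,y)\}\le\ell(x,z)$; write $x\le y$ if $\ell(x,y)\ge0$. A metric measure spacetime $(M,\tau,\ell,\mathfrak m)$: $\tau$ is a Polish topology, $\ell$ a time separation with $\le$ a partial order and $\{\ell\ge0\}$ closed in $M^2$, $\mathfrak m$ a non-zero non-negative Radon measure. $\gamma:[0,1]\to M$ is causal if $s\le t$ implies $\gamma_s\le\gamma_t$. Its causal speed $|\dot\gamma_t|\in[0,+\infty]$ is the density of the absolutely continuous part (w.r.t. Lebesgue measure) of the largest Borel measure $\nu$ on $[0,1]$ with $\nu((a,b))\le\ell(\gamma_a,\gamma_b)$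 for all $0\le a<b\le1$; for a.e. $t$ it equals $\lim_{h\downarrow0}\ell(\gamma_t,\gamma_{t+h})/h$. $\mathrm{LCC}([0,1];M)$ is the set of left-continuous causal curves with the topology of the distance $\mathsf D(\gamma,\eta)=\mathsf d(\gamma_0,\eta_0)+\int_0^1\mathsf d(\gamma_t,\eta_t)\,\mathrm dt$, $\mathsf d$ a bounded distance inducing $\tau$. $\mathsf e_t(\gamma):=\gamma_t$. A causal function is an $\mathfrak m$-measurable $f:M\to\bar{\mathbb R}$ such that $x\le y$ implies $f(x)\le f(y)$. A test plan is a Borel probability measure $\boldsymbol\pi$ on $\mathrm{LCC}([0,1];M)$ such that for some $C>0$, $(\mathsf e_t)_*\boldsymbol\pi\le C\mathfrak m$ for all $t\in[0,1]$. A Borel $G:M\to[0,+\infty]$ is a weak subslope of $f$ if $\int[f(\gamma_1)-f(\gamma_0)]\,\mathrm d\boldsymbol\pi\ge\iint_0^1G(\gamma_t)|\dot\gamma_t|\,\mathrm dt\,\mathrm d\boldsymbol\pi$ for every test plan $\boldsymbol\pi$; $|\mathrm df|$ denotes the $\mathfrak m$-a.e. largest weak subslope (it exists and is $\mathfrak m$-a.e. unique). (One has $|\mathrm df|=+\infty$ $\mathfrak m$-a.e. where $f\notin\mathbb R$.) For a test plan $\boldsymbol\pi$ let $\rho_{\boldsymbol\pi}$ be the $\mathfrak m$-density of the push-forward of the measure $|\dot\gamma_t|\,\mathrm d\boldsymbol\pi(\gamma)\,\mathrm dt$ on $\mathrm{LCC}([0,1];M)\times[0,1]$ under $(\gamma,t)\mapsto\gamma_t$.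 $\mathrm{Vis}(M)$ is the $\mathfrak m$-essential union of the sets $\{\rho_{\boldsymbol\pi}>0\}$ over all test plans $\boldsymbol\pi$ (the smallest Borel set, up to $\mathfrak m$-null sets, containing each of them up to $\mathfrak m$-null sets). *)

(* Defs.v *)
From HB Require Import structures.
From mathcomp Require Import all_boot all_order all_algebra.
From mathcomp Require Import all_classical all_reals all_analysis.
From mathcomp Require Import measurable_realfun.

Set Implicit Arguments.
Unset Strict Implicit.
Unset Printing Implicit Defensive.

Import Order.TTheory GRing.Theory Num.Theory.
Import numFieldNormedType.Exports.

Local Open Scope classical_set_scope.
Local Open Scope ring_scope.

Definition borel (T : ptopologicalType) := g_sigma_algebraType (@open T).

Section metrics.
Context {R : realType}.

Definition is_distance (T : Type) (d : T -> T -> R) :=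
  [/\ forall x y, 0 <= d x y,
      forall x y, d x y = 0 <-> x = y,
      forall x y, d x y = d y x &
      forall x y z, d x z <= d x y + d y z].

Definition induces_topology (T : topologicalType) (d : T -> T -> R) :=
  forall (x : T) (A : set T),
    nbhs x A <-> exists2 e : R, 0 < e & [set y | d x y < e] `<=` A.

Definition cauchy_complete (T : Type) (d : T -> T -> R) :=
  forall u : nat -> T,
    (forall e : R, 0 < e -> exists N : nat, forall m n : nat,
       (N <= m)%N -> (N <= n)%N -> d (u m) (u n) < e) ->
    exists x : T, forall e : R, 0 < e -> exists N : nat, forall n : nat,
       (N <= n)%N -> d x (u n) < e.

Definition polish (T : topologicalType) :=
  (exists2 S : set T, countable S & dense S) /\
  (exists d : T -> T -> R,
     [/\ is_distance d, induces_topology d & cauchy_complete d]).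

Definition bounded_distance_inducing (T : topologicalType)
    (d : T -> T -> R) :=
  [/\ is_distance d, induces_topology d &
      exists K : R, forall x y, d x y <= K].

End metrics.

Section measures.
Local Open Scope ereal_scope.
Context {R : realType}.

Definition radon (T : ptopologicalType) (m : set (borel T) -> \bar R) :=
  (forall x : T, exists U : set T, [/\ open U, U x & m U < +oo]) /\
  (forall A : set (borel T), measurable A ->
     m A = ereal_sup [set m K | K in [set K : set T |
       [/\ compact K, measurable (K : set (borel T)) & K `<=` A]]]).

Definition measurable_up_to_null d (T : measurableType d)
    (m : set T -> \bar R) (f : T -> \bar R) :=
  forall B : set (\bar R), measurable B -> completed_algebra_gen m (f @^-1` B).

(* Used for functions whose measurability is not known a priori; it is the
   ordinary integral on measurable functions, see [upper_integralE]. *)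
Definition upper_integral d (T : measurableType d) (mu : set T -> \bar R)
    (h : T -> \bar R) : \bar R :=
  ereal_inf [set \int[mu]_x k x | k in [set k : T -> \bar R |
    measurable_fun setT k /\ forall x, h x <= k x]].

Lemma upper_integralE d (T : measurableType d)
    (mu : {measure set T -> \bar R}) (h : T -> \bar R) :
  measurable_fun setT h -> (forall x, 0 <= h x) ->
  upper_integral mu h = \int[mu]_x h x.
Proof.
move=> mh h0; apply/eqP; rewrite eq_le; apply/andP; split.
  by apply: ereal_inf_lbound; exists h.
apply: le_ereal_inf_tmp => _ [k [mk hk] <-].
by apply: ge0_le_integral => // x _; exact: le_trans (h0 x) (hk x).
Qed.

(* Addition with +oo + z = +oo and -oo + z = -oo for every z. *)
Definition ladde (x y : \bar R) : \bar R :=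
  if x is r%:E then r%:E + y else x.

(* Subtraction with +oo - +oo = -oo - -oo = +oo. *)
Definition esub (x y : \bar R) : \bar R :=
  match x, y with
  | +oo, +oo => +oo
  | -oo, -oo => +oo
  | _, _ => x - y
  end.

End measures.

Section spacetimes.
Local Open Scope ereal_scope.

Definition time_separation (R : realType) (T : Type) (l : T -> T -> \bar R) :=
  [/\ forall x y, l x y = -oo \/ 0 <= l x y,
      forall x, l x x = 0 &
      forall x y z,
        mine (ladde (l x y) (l y z)) (ladde (l y z) (l x y)) <= l x z].

(* The carrier is pointed because the measurable types of the library are;
   this is no restriction, as the measure is non-zero. *)
Record mm_spacetime (R : realType) := MMSpacetime {
  mms_carrier :> ptopologicalType ;
  mms_ell : mms_carrier -> mms_carrier -> \bar R ;
  mms_measure : {measure set (borel mms_carrier) -> \bar R} ;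
  mms_polish : @polish R mms_carrier ;
  mms_time_separation : time_separation mms_ell ;
  mms_le_refl : forall x, 0 <= mms_ell x x ;
  mms_le_trans : forall x y z,
    0 <= mms_ell x y -> 0 <= mms_ell y z -> 0 <= mms_ell x z ;
  mms_le_anti : forall x y,
    0 <= mms_ell x y -> 0 <= mms_ell y x -> x = y ;
  mms_closed : closed [set p : mms_carrier * mms_carrier |
    0 <= mms_ell p.1 p.2] ;
  mms_radon : radon mms_measure ;
  mms_nonzero : mms_measure setT != 0
}.

Definition mms_le (R : realType) (M : mm_spacetime R) (x y : M) :=
  0 <= mms_ell x y.

End spacetimes.

Section curves.
Context {R : realType} (M : mm_spacetime R).

(* Curves on [0, 1] are encoded as functions on R that are constant on
   ]-oo, 0] and on [1, +oo[, so that equality of curves is equality on [0, 1]. *)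
Record lcc := LCC {
  lcc_fun :> R -> M ;
  lcc_causal : forall s t, 0 <= s -> s <= t -> t <= 1 ->
    mms_le (lcc_fun s) (lcc_fun t) ;
  lcc_left_continuous : forall t, 0 < t -> t <= 1 ->
    lcc_fun s @[s --> t^'-] --> lcc_fun t ;
  lcc_constant_left : forall t, t <= 0 -> lcc_fun t = lcc_fun 0 ;
  lcc_constant_right : forall t, 1 <= t -> lcc_fun t = lcc_fun 1
}.

HB.instance Definition _ := gen_eqMixin lcc.
HB.instance Definition _ := gen_choiceMixin lcc.

Definition lcc_cst : lcc.
Proof.
apply: (@LCC (cst point)) => // [s t _ _ _|t _ _]; first exact: mms_le_refl.
exact: cvg_cst.
Defined.

HB.instance Definition _ := isPointed.Build lcc lcc_cst.

Definition lcc_dist (d : M -> M -> R) (g h : lcc) : R :=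
  d (g 0) (h 0) + \int[lebesgue_measure]_(t in `[0, 1]) d (g t) (h t).

Definition lcc_open (d : M -> M -> R) : set (set lcc) :=
  [set U | forall g, U g ->
     exists2 e : R, 0 < e & [set h | lcc_dist d g h < e] `<=` U].

Definition borel_lcc (d : M -> M -> R) := g_sigma_algebraType (lcc_open d).

Local Open Scope ereal_scope.

Definition speed_admissible (g : lcc)
    (nu : {measure set (measurableTypeR R) -> \bar R}) :=
  nu (~` `[0%R, 1%R]%classic) = 0 /\
  forall a b : R, (0 <= a)%R -> (a < b)%R -> (b <= 1)%R ->
    nu `]a, b[%classic <= mms_ell (g a) (g b).

Definition largest_speed_measure (g : lcc)
    (nu : {measure set (measurableTypeR R) -> \bar R}) :=
  speed_admissible g nu /\
  forall nu' : {measure set (measurableTypeR R) -> \bar R},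
    speed_admissible g nu' -> forall A, measurable A -> nu' A <= nu A.

(* The absolutely continuous part of nu is A |-> inf { nu (A \ N) | N null }.
   For sigma-finite nu this is the one of the Lebesgue decomposition; the
   largest measure of a causal curve, however, need not be sigma-finite (it is
   +oo on every nonempty set if ell (g a) (g b) = +oo for all a < b), and then
   the Lebesgue decomposition may fail to exist. *)
Definition ac_part (nu : set (measurableTypeR R) -> \bar R)
    (A : set (measurableTypeR R)) : \bar R :=
  ereal_inf [set nu (A `\` N) | N in [set N : set (measurableTypeR R) |
    measurable N /\ lebesgue_measure N = 0]].

Definition is_causal_speed (g : lcc) (v : measurableTypeR R -> \bar R) :=
  [/\ measurable_fun setT v, forall t, 0 <= v t &
      exists2 nu : {measure set (measurableTypeR R) -> \bar R},
        largest_speed_measure g nu &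
        forall A : set (measurableTypeR R), measurable A -> A `<=` `[0%R, 1%R]%classic ->
          \int[lebesgue_measure]_(t in A) v t = ac_part nu A].

(* A version of the causal speed, which is only determined up to null sets of
   times; below it only occurs under an integral in time at fixed g. *)
Definition causal_speed (g : lcc) : R -> \bar R :=
  xget (cst 0) [set v : R -> \bar R | is_causal_speed g v].

Definition causal_function (f : M -> \bar R) :=
  measurable_up_to_null (mms_measure M) (f : borel M -> \bar R) /\
  forall x y : M, mms_le x y -> f x <= f y.

Definition test_plan (d : M -> M -> R) (pi : probability (borel_lcc d) R) :=
  exists2 C : R, (0 < C)%R &
    forall t : R, (0 <= t)%R -> (t <= 1)%R ->
    forall A : set (borel M), measurable A ->
      pushforward pi (fun g : borel_lcc d => (g : lcc) t : borel M) A
        <= C%:E * mms_measure M A.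

(* No measurability of ell is assumed, so that the integral in time need not be
   a measurable function of the curve: hence the upper integral. *)
Definition weak_subslope (d : M -> M -> R) (f G : M -> \bar R) :=
  [/\ measurable_fun setT (G : borel M -> \bar R), forall x, 0 <= G x &
      forall pi : probability (borel_lcc d) R, test_plan pi ->
        upper_integral pi (fun g : borel_lcc d =>
          \int[lebesgue_measure]_(t in `[0%R, 1%R])
            (G ((g : lcc) t) * causal_speed g t))
        <= \int[pi]_g esub (f ((g : lcc) 1%R)) (f ((g : lcc) 0%R))].

(* "df is |df|", the latter being defined up to null sets. *)
Definition is_slope (d : M -> M -> R) (f df : M -> \bar R) :=
  weak_subslope d f df /\
  forall G : M -> \bar R, weak_subslope d f G ->
    {ae mms_measure M, forall x, G x <= df x}.

(* The push-forward of |g'_t| dpi(g) dt under (g, t) |-> g_t. *)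
Definition speed_pushforward (d : M -> M -> R)
    (pi : probability (borel_lcc d) R) (A : set M) : \bar R :=
  upper_integral pi (fun g : borel_lcc d =>
    \int[lebesgue_measure]_(t in `[0%R, 1%R])
      ((\1_A ((g : lcc) t))%:E * causal_speed g t)).

Definition speed_density (d : M -> M -> R)
    (pi : probability (borel_lcc d) R) (rho : M -> \bar R) :=
  [/\ measurable_fun setT (rho : borel M -> \bar R), forall x, 0 <= rho x &
      forall A : set (borel M), measurable A ->
        speed_pushforward pi A = \int[mms_measure M]_(x in A) rho x].

Definition contains_speed_densities (d : M -> M -> R) (V : set (borel M)) :=
  forall pi : probability (borel_lcc d) R, test_plan pi ->
  forall rho : M -> \bar R, speed_density pi rho ->
    mms_measure M ([set x | 0 < rho x] `\` V) = 0.

(* "V is Vis(M)", the latter being defined up to null sets. *)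
Definition is_vis (d : M -> M -> R) (V : set (borel M)) :=
  [/\ measurable V, contains_speed_densities d V &
      forall W : set (borel M), measurable W -> contains_speed_densities d W ->
        mms_measure M (V `\` W) = 0].

End curves.

(* Main.v *)
(* Testing a weak subslope G of f against plans conditioned on a Borel set of
   curves and restricted to a time interval [s, t] turns the integral inequality
   into a pointwise one: for almost every curve g of a test plan,
   int_s^t G(g_r) |g'_r| dr <= f(g_t) - f(g_s) for all rational s < t. Conversely
   the case s = 0, t = 1 of these inequalities makes G a weak subslope. Locality
   thus reduces to the real line, for monotone g1 and g2 with densities w1 and w2
   below their increments: where g1 - g2 takes values in a null set, its
   difference quotients accumulate at 0, so w1 is also below the increments of
   g2 there. Hence |df1| on {f1 - f2 in E}, |df2| elsewhere, is a weak subslope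
   of f2. *)

From HB Require Import structures.
Require Import Defs.
From mathcomp Require Import all_boot all_order all_algebra.
From mathcomp Require Import all_classical all_reals all_analysis.
From mathcomp Require Import measurable_realfun ring lra.

Set Implicit Arguments.
Unset Strict Implicit.
Unset Printing Implicit Defensive.

Import Order.TTheory GRing.Theory Num.Theory.
Import numFieldNormedType.Exports.

Local Open Scope classical_set_scope.
Local Open Scope ring_scope.

(** * Locality on the real line *)

(** Along a curve, [f1] and [f2] are monotone but need be neither continuous nor absolutely
    continuous, so inequalities between derivatives cannot simply be integrated back. Instead,
    approximate inequalities on arbitrarily short intervals to the right of almost every time are
    summed over a Vitali cover. Difference quotients accumulate at 0 because, on the exceptional
    set, the difference is locally expanding with values in a null set: its inverse is locally
    Lipschitz, so the exceptional set is null. Two obstacles shape the passage to curves. The time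
    integral may be a nonmeasurable function of the curve, so the conditioning sets are measurable
    hulls, and increments are compared through measurable majorants and minorants. Restricted curves
    must fit the definitions again: restriction has to be Borel on [lcc], where it need not be
    continuous, and its causal speed has to be computed from largest measures that may be infinite.
    A common infinite value of [f1] and [f2] is not a case of a difference in a real set [E]; there
    both slopes are shown to be [+oo]. *)

Section null_preimages.
Local Open Scope ereal_scope.
Context {R : realType}.
Notation mu := (@lebesgue_measure R).

(** Lebesgue outer measure is an infimum over covers by half-open intervals. Closing the intervals,
    and replacing the empty ones by a point, does not change the total length. *)
Lemma null_set_itv_cover (E : set (measurableTypeR R)) (e : R) :
  mu E = 0 -> (0 < e)%R ->
  exists a b : nat -> R, [/\ forall n, (a n <= b n)%R,
    forall x, E x -> exists n, (a n <= x <= b n)%R &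
    \sum_(n <oo) (b n - a n)%:E < e%:E].
Proof.
move=> E0 e0.
have /ereal_inf_lt[z [/= M covEM sMz ze]] : mu E < e%:E by rewrite E0 lte_fin.
have cM n : exists ab : R * R, (ab.1 <= ab.2)%R /\ M n = `]ab.1, ab.2]%classic.
  have /ocitvP[-> | [[a b /= alb ->]]] : ocitv (M n) by case: covEM => /(_ n).
    by exists (0%R, 0%R); split => //=; rewrite set_itvoc0.
  by exists (a, b); split => //=; exact: ltW.
have [ab abM] := choice cM.
exists (fst \o ab), (snd \o ab); split.
- by move=> n; have [] := abM n.
- move=> x Ex; have [n _] := covEM.2 x Ex.
  have [_ ->] := abM n; rewrite /= in_itv/= => /andP[ax xb].
  by exists n; rewrite (ltW ax).
- apply: le_lt_trans ze; rewrite -sMz; apply: lee_nneseries.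
    by move=> n _; rewrite lee_fin subr_ge0; have [] := abM n.
  move=> n _; have [ablt ->] := abM n.
  rewrite /= wlength_itv /= lte_fin; case: ltP => [_|ba].
    by rewrite EFinB.
  by rewrite lee_fin /=; lra.
Qed.

(* u has a (1/c)-Lipschitz inverse on S, and Lipschitz maps preserve null sets. *)
Lemma negligible_expanding (u : R -> R) (E : set (measurableTypeR R))
    (S : set R) (c : R) : (0 < c)%R ->
  mu E = 0 -> (forall x, S x -> E (u x)) ->
  (forall x y, S x -> S y -> (c * `|x - y| <= `|u x - u y|)%R) ->
  mu.-negligible (S : set (measurableTypeR R)).
Proof.
move=> c0 E0 SE Sc; apply/negligible_outer_measure.
apply/eqP; rewrite eq_le outer_measure_ge0 andbT.
apply/lee_addgt0Pr => e e0; rewrite add0e.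
(* The part of [S] sent into an interval of length [L] has diameter at most [L / c], hence lies in
   an interval of length [2 * L / c] centred at any of its points; total length [c * e / 2] thus
   becomes [e]. *)
have ce0 : (0 < c * e / 2)%R by rewrite divr_gt0// mulr_gt0.
have [a [b [ab Eab sab]]] := null_set_itv_cover E0 ce0.
pose Sn n := S `&` [set x | (a n <= u x <= b n)%R].
have hc n : exists z : R, Sn n `<=`
    `[(z - (b n - a n) / c)%R, (z + (b n - a n) / c)%R]%classic.
  have [->|/set0P[z [Sz /= uz]]] := eqVneq (Sn n) set0.
    by exists 0%R => x.
  exists z => x [Sx /= ux]; rewrite in_itv/= -ler_distl.
  rewrite ler_pdivlMr// mulrC (le_trans (Sc _ _ Sx Sz))//.
  by rewrite ler_norml; move/andP : uz ux => [? ?] /andP[? ?]; lra.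
have [z zS] := choice hc.
pose I n := `[(z n - (b n - a n) / c)%R, (z n + (b n - a n) / c)%R]%classic.
have SI : S `<=` \bigcup_n I n.
  move=> x Sx; have [n xn] := Eab _ (SE _ Sx).
  by exists n => //; apply: zS; split.
rewrite (le_trans (le_outer_measure (mu_ext (@wlength R idfun)) _ _ SI))//.
rewrite (le_trans (outer_measure_sigma_subadditive (mu_ext (@wlength R idfun))
  _))//.
have muI n : mu (I n) = (2 / c)%:E * (b n - a n)%:E.
  rewrite lebesgue_measure_itv/= lte_fin -EFinM -EFinB.
  case: ltP => h; congr EFin; first by field; rewrite gt_eqF.
  have h1 : (0 <= (b n - a n) / c)%R by rewrite divr_ge0// ?subr_ge0// ltW.
  have h2 : ((b n - a n) / c = 0)%R by lra.
  by rewrite mulrAC -mulrA h2 mulr0.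
apply: (@le_trans _ _ (\sum_(n <oo) ((2 / c)%:E * (b n - a n)%:E))).
  apply: lee_nneseries => n _; last by rewrite -muI.
  by move=> ?; exact: (outer_measure_ge0 (mu_ext (@wlength R idfun))).
rewrite nneseriesZl; last by move=> n _; rewrite lee_fin subr_ge0.
rewrite -lee_pdivlMl ?divr_gt0// (le_trans (ltW sab))// -EFinM lee_fin.
by rewrite invf_div mulrAC.
Qed.

(** Any two points of a slice of [S] of width [r] satisfy the expansion bound, so each slice is null
    by [negligible_expanding]. Nonnegativity lets natural numbers index the slices. *)
Lemma negligible_locally_expanding (u : R -> R) (E : set (measurableTypeR R))
    (S : set R) (c r : R) : (0 < c)%R -> (0 < r)%R ->
  mu E = 0 -> (forall x, S x -> (0 <= x)%R /\ E (u x)) ->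
  (forall x y, S x -> S y -> (x < y < x + r)%R ->
    (c * (y - x) <= `|u y - u x|)%R) ->
  mu.-negligible (S : set (measurableTypeR R)).
Proof.
move=> c0 r0 E0 SE Sc.
pose Sn n := S `&` [set x | (n%:R * r <= x < n.+1%:R * r)%R].
have SU : S `<=` \bigcup_n Sn n.
  move=> x Sx; exists (Num.truncn (x / r)) => //; split => //=.
  have := truncn_itv (divr_ge0 (SE _ Sx).1 (ltW r0)).
  by rewrite ler_pdivlMr// ltr_pdivrMr.
apply: (@negligibleS _ _ _ mu _ _ SU).
apply: negligible_bigcup => n.
have key x y : Sn n x -> Sn n y -> (x < y)%R -> (c * `|x - y| <= `|u x - u y|)%R.
  move=> [Sx /=/andP[xn xn1]] [Sy /=/andP[yn yn1]] xy.
  rewrite distrC gtr0_norm ?subr_gt0// distrC; apply: Sc => //.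
  by rewrite xy/=; move: yn1; rewrite -natr1 mulrDl mul1r; lra.
apply: (@negligible_expanding u E _ c) => //.
  by move=> x [Sx _]; exact: (SE _ Sx).2.
move=> x y Sx Sy; have [xy|yx|->] := ltgtP x y.
- exact: key.
- by rewrite distrC [leRHS]distrC; exact: key.
- by rewrite !subrr normr0 mulr0.
Qed.

End null_preimages.

(** * Integrals to the right of a Lebesgue point *)

Section one_sided_lebesgue_points.
Local Open Scope ereal_scope.
Context {R : realType}.
Notation mu := (@lebesgue_measure R).

Lemma integral_itv_cst (a b c : R) : (a <= b)%R ->
  \int[mu]_(x in `[a, b]) c%:E = (c * (b - a))%:E.
Proof.
move=> ab; rewrite integral_cst//= lebesgue_measure_itv/= lte_fin.
case: ltP => [_|ba]; first by rewrite -EFinB EFinM.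
by have -> : (b - a = 0)%R by lra; rewrite mule0 mulr0.
Qed.

Lemma lebesgue_pt_right (f : R -> R) (t e : R) :
  measurable_fun setT f -> (forall x, 0 <= f x)%R -> lebesgue_pt f t ->
  (0 < e)%R ->
  exists2 r : R, (0 < r)%R & forall y, (t < y < t + r)%R ->
    ((f t - e) * (y - t))%:E <= \int[mu]_(x in `[t, y]) (f x)%:E /\
    \int[mu]_(x in `[t, y]) (f x)%:E <= ((f t + e) * (y - t))%:E.
Proof.
move=> mf f0 ft e0.
(* The ball of radius [y - t] around [t] is twice as long as [[t, y]], hence [e / 2]. *)
have : \forall r \near (0%R : R)^'+, davg f t r < (e / 2)%:E.
  apply: (ft [set x | x < (e / 2)%:E]).
  by apply: open_ereal_lt'; rewrite lte_fin divr_gt0.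
move=> /nbhs_ballP[r /= r0 rP]; exists r => // y /andP[ty yr].
have yt0 : (0 < y - t)%R by rewrite subr_gt0.
have {rP} := rP (y - t)%R; rewrite /ball/= sub0r normrN gtr0_norm//.
move=> /(_ ltac:(lra) yt0);
  rewrite /davg /iavg lebesgue_measure_ball ?(ltW yt0)//.
rewrite inver mulrn_eq0/= gt_eqF//= lte_pdivrMl ?mulrn_wgt0//.
rewrite -EFinM.
have -> : ((y - t) *+ 2 * (e / 2) = e * (y - t))%R by rewrite mulr2n; field.
set J := integral _ _ _ => /ltW Je.
have mfE (D : set R) : measurable_fun D (EFin \o f).
  by apply/measurable_EFinP; exact: measurable_funTS.
have mfa (D : set R) : measurable_fun D (fun x => `|f x - f t|%:E).
  apply/measurable_EFinP; apply: measurable_funTS; apply: measurableT_comp => //.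
  by apply: measurable_funB => //.
have KJ : \int[mu]_(x in `[t, y]) `|f x - f t|%:E <= (e * (y - t))%:E.
  apply: le_trans Je; rewrite -integral_itv_bndo_bndc//.
  apply: ge0_subset_integral => //.
  - exact: measurable_ball.
  - exact: mfa.
  - move=> x /=; rewrite in_itv/= => /andP[tx xy].
    by rewrite /ball/= ltr_distlC; apply/andP; split; lra.
split.
- rewrite mulrBl EFinB leeBlDr//.
  apply: (@le_trans _ _ (\int[mu]_(x in `[t, y]) ((f x)%:E + `|f x - f t|%:E))).
    rewrite -integral_itv_cst ?(ltW ty)//; apply: ge0_le_integral => //.
    - by move=> x _; rewrite lee_fin; exact: f0.
    - by apply: emeasurable_funD; [exact: mfE|exact: mfa].
    - move=> x _; rewrite -EFinD lee_fin.
      have := ler_norm (f t - f x)%R; rewrite distrC; lra.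
  rewrite ge0_integralD//; [exact: leeD2l| |exact: mfE|exact: mfa].
  by move=> x _; rewrite lee_fin; exact: f0.
- rewrite mulrDl EFinD.
  apply: (@le_trans _ _ (\int[mu]_(x in `[t, y]) ((f t)%:E + `|f x - f t|%:E))).
    apply: ge0_le_integral => //.
    - by move=> x _; rewrite lee_fin; exact: f0.
    - exact: mfE.
    - by apply: emeasurable_funD; [exact: measurable_cst|exact: mfa].
    - move=> x _; rewrite -EFinD lee_fin.
      have := ler_norm (f x - f t)%R; lra.
  rewrite ge0_integralD//; [|by move=> x _; rewrite lee_fin;
    exact: f0|exact: mfa].
  by rewrite integral_itv_cst ?(ltW ty)// leeD2l.
Qed.

End one_sided_lebesgue_points.

(** * From bounds on short intervals to a bound on [[0, 1]] *)

Section growth.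
Local Open Scope ereal_scope.
Context {R : realType}.
Notation mu := (@lebesgue_measure R).

Lemma ge0_integral_setU_le (A B : set R) (f : R -> \bar R) :
  measurable A -> measurable B -> measurable_fun setT f ->
  (forall x, 0 <= f x) ->
  \int[mu]_(x in A `|` B) f x <= \int[mu]_(x in A) f x + \int[mu]_(x in B) f x.
Proof.
move=> mA mB mf f0; have mBA : measurable (B `\` A) by exact: measurableD.
have mfS (D : set R) : measurable_fun D f by exact: measurable_funTS.
have -> : A `|` B = A `|` (B `\` A).
  apply/seteqP; split=> x [Ax|]; [by left| |by left|by case; right].
  by have [Ax|Ax] := pselect (A x); [left|right].
rewrite ge0_integral_setU//; [|exact: mfS|by apply/eqP; rewrite setDIK].
by rewrite leeD2l//; apply: ge0_subset_integral => //; exact: mfS.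
Qed.

(** Moving the endpoints costs at most [n] times the displacement; this is how integrals pass
    between real and rational endpoints. *)
Lemma integral_itv_split_le (p : R -> R) (n a t y b : R) :
  measurable_fun setT p -> (forall x, 0 <= p x <= n)%R ->
  (a <= t)%R -> (t <= y)%R -> (y <= b)%R ->
  \int[mu]_(x in `[a, b]) (p x)%:E <= (n * (t - a))%:E +
    (\int[mu]_(x in `[t, y]) (p x)%:E + (n * (b - y))%:E).
Proof.
move=> mp pn at_ ty yb.
have p0 x : 0 <= (p x)%:E by rewrite lee_fin; have /andP[] := pn x.
have mpE (D : set R) : measurable_fun D (EFin \o p).
  by apply/measurable_EFinP; exact: measurable_funTS.
have -> : `[a, b]%classic = `[a, t] `|` (`[t, y] `|` `[y, b]) :> set R.
  apply/seteqP; split=> x /=; rewrite !in_itv/=.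
    move=> /andP[ax xb]; have [xt|tx] := leP x t; first by left; rewrite ax.
    have [xy|yx] := leP x y; first by right; left; rewrite (ltW tx).
    by right; right; rewrite (ltW yx).
  by move=> [|[|]] /andP[? ?]; apply/andP; split; lra.
have len (u v : R) : (u <= v)%R ->
    \int[mu]_(x in `[u, v]) (p x)%:E <= (n * (v - u))%:E.
  move=> uv; rewrite -integral_itv_cst//.
  apply: ge0_le_integral => //; first exact: mpE.
  by move=> x _; rewrite lee_fin; have /andP[] := pn x.
apply: (le_trans (ge0_integral_setU_le _ _ (mpE setT) p0)) => //.
  exact: measurableU.
apply: leeD; first exact: len.
apply: (le_trans (ge0_integral_setU_le _ _ (mpE setT) p0)) => //.
by apply: leeD => //; exact: len.
Qed.

(** Rational endpoints make the Vitali cover below countable. Widening [[t, y]] can only increase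
    the increment of [h], and passing from [e] to [2 * e] pays for the integral over the two added
    pieces. *)
Lemma rational_growth_itv (p h : R -> R) (n e t y d : R) :
  measurable_fun setT p -> (forall x, 0 <= p x <= n)%R ->
  (forall x y, 0 <= x -> x <= y -> y <= 1 -> h x <= h y)%R -> (0 < e)%R ->
  (0 < t)%R -> (t < y)%R -> (y < 1)%R -> (y < t + d)%R ->
  \int[mu]_(x in `[t, y]) (p x)%:E <= (h y - h t + e * (y - t))%:E ->
  exists a b : rat, [/\ (0 < (ratr a : R) < t)%R, (y < (ratr b : R) < 1)%R,
    ((ratr b : R) < ratr a + d)%R &
    \int[mu]_(x in `[ratr a, ratr b]) (p x)%:E <=
      (h (ratr b) - h (ratr a) + 2 * e * (ratr b - ratr a))%:E].
Proof.
move=> mp pn ndh e0 t0 ty y1 ytd yP.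
have p0 x : 0 <= (p x)%:E by rewrite lee_fin; have /andP[] := pn x.
have mpE (D : set R) : measurable_fun D (EFin \o p).
  by apply/measurable_EFinP; exact: measurable_funTS.
have n0 : (0 <= n)%R by have /andP[] := pn 0%R; exact: le_trans.
(* Widening both ends by at most [s] adds at most [2 * n * s <= e * (y - t)] to the integral. *)
pose s := (e * (y - t) / (2 * (n + 1)))%R.
have s0 : (0 < s)%R.
  by rewrite divr_gt0// ?mulr_gt0// ?subr_gt0//; lra.
have yt0 : (0 < y - t)%R by lra.
have ns : (n * (2 * s) <= e * (y - t))%R.
  rewrite /s; have -> : (n * (2 * (e * (y - t) / (2 * (n + 1)))) =
    (e * (y - t)) * (n / (n + 1)))%R by field; lra.
  by rewrite ler_piMr ?mulr_ge0 ?(ltW e0) ?(ltW yt0)// ler_pdivrMr; lra.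
clearbody s.
(* The bound [y - d < a] leaves room for [b] between [y] and [a + d]. *)
have h1 : (Num.max 0 (Num.max (t - s) (y - d)) < t)%R.
  by rewrite !gt_max t0/=; apply/andP; split; lra.
have [a] := rat_in_itvoo h1.
rewrite in_itv/= !gt_max => /andP[/and3P[a0 sa da] at_].
have h3 : (y < Num.min 1 (Num.min (y + s) (ratr a + d)))%R.
  by rewrite !lt_min; apply/and3P; split; lra.
have [b] := rat_in_itvoo h3.
rewrite in_itv/= !lt_min => /andP[yb /and3P[b1 bs bd]].
exists a, b; rewrite a0 at_ yb b1 bd; split => //.
move: (ratr a : R) (ratr b : R) {h1 h3} => {}a {}b in a0 sa da at_ yb b1 bs bd *.
apply: (le_trans (integral_itv_split_le mp pn (ltW at_) (ltW ty) (ltW yb))).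
rewrite addeCA -EFinD (le_trans (leeD2r _ yP))// -EFinD lee_fin.
have q1 : (h y <= h b)%R by apply: ndh; lra.
have q2 : (h a <= h t)%R by apply: ndh; lra.
have q3 : (n * (t - a) <= n * s)%R by rewrite ler_wpM2l//; lra.
have q4 : (n * (b - y) <= n * s)%R by rewrite ler_wpM2l//; lra.
have q5 : (e * (y - t) <= e * (b - a))%R by rewrite ler_wpM2l// ?(ltW e0)//; lra.
by lra.
Qed.

(* The almost-covering disjoint intervals [a, b] of Vitali's theorem have
   disjoint images ]h a, h b[ in [h 0, h 1], which sums the increments of h. *)
Lemma le_integral_itv_of_fine_cover (p h : R -> R) (n e : R) :
  measurable_fun setT p -> (forall x, 0 <= p x <= n)%R ->
  (forall x y, 0 <= x -> x <= y -> y <= 1 -> h x <= h y)%R -> (0 < e)%R ->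
  {ae mu, forall t, (0 < t < 1)%R -> forall r : R, (0 < r)%R ->
     exists2 y, (t < y < t + r)%R &
       \int[mu]_(x in `[t, y]) (p x)%:E <= (h y - h t + e * (y - t))%:E} ->
  \int[mu]_(x in `[0%R, 1%R]) (p x)%:E <= (h 1%R - h 0%R + 2 * e)%:E.
Proof.
move=> mp pn ndh e0 [N [mN N0 subN]].
have p0 x : 0 <= (p x)%:E by rewrite lee_fin; have /andP[] := pn x.
have mpE (D : set R) : measurable_fun D (EFin \o p).
  by apply/measurable_EFinP; exact: measurable_funTS.
pose ok (ab : R * R) := [/\ (0 <= ab.1)%R, (ab.1 < ab.2)%R, (ab.2 <= 1)%R &
  \int[mu]_(x in `[ab.1, ab.2]) (p x)%:E <=
    (h ab.2 - h ab.1 + 2 * e * (ab.2 - ab.1))%:E].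
(* Useless codes receive [(0, 2)]: nondegenerate, so that every ball has positive radius, but not
   [ok] since 2 exceeds 1. *)
pose ab k : R * R := if unpickle k is Some (a, b) then
  (if (a : rat) < b then (ratr a, ratr b) else (0, 2))%R else (0, 2)%R.
have ablt k : ((ab k).1 < (ab k).2)%R.
  rewrite /ab; case: unpickle => [[a b]|/=]; last by lra.
  by case: ifPn => /=; [rewrite ltr_rat|lra].
pose c k := (((ab k).1 + (ab k).2) / 2)%R.
pose r k := (((ab k).2 - (ab k).1) / 2)%R.
have r0 k : (0 < r k)%R by rewrite divr_gt0// subr_gt0.
pose B k := ball (c k) (r k).
pose V := [set k | ok (ab k)].
have clB k : closure (B k) = `[(ab k).1, (ab k).2]%classic.
  rewrite -/(closed_ball (c k) (r k)) closed_ballE//.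
  apply/seteqP; split=> x; rewrite /closed_ball_/= in_itv/= ler_distlC /c /r.
    by move=> /andP[? ?]; apply/andP; split; lra.
  by move=> /andP[? ?]; apply/andP; split; lra.
pose A := `]0%R, 1%R[%classic `\` N.
have vit : vitali_cover A B V.
  split; first by move=> k; exact: is_ball_ball.
  move=> t [/=]; rewrite in_itv/= => t01 Nt d d0.
  have : (forall r : R, (0 < r)%R ->
     exists2 y, (t < y < t + r)%R &
       \int[mu]_(x in `[t, y]) (p x)%:E <= (h y - h t + e * (y - t))%:E).
    by apply: contrapT => tP; apply: Nt; apply: subN => /(_ t01).
  have m0 : (0 < Num.min (1 - t) d)%R.
    by rewrite lt_min d0 subr_gt0; case/andP : t01 => _ ->.
  move=> /(_ _ m0) [y /andP[ty]]; rewrite -ltrBlDl lt_min => /andP[yt1 ytd] yP.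
  have y1 : (y < 1)%R by lra.
  have ytd' : (y < t + d)%R by lra.
  move/andP : t01 => [t0 t1].
  have [a [b [/andP[a0 at_] /andP[yb b1] bad abP]]] :=
    rational_growth_itv mp pn ndh e0 t0 ty y1 ytd' yP.
  have abab : (ratr a < ratr b :> R)%R by lra.
  have [k abE] : exists k, ab k = (ratr a, ratr b).
    by exists (pickle (a, b)); rewrite /ab pickleK -(ltr_rat R) abab.
  exists k; split.
  - by rewrite /V/= abE/=; split => //; exact: ltW.
  - by rewrite /B /c /r abE /= /ball /= ltr_distlC; apply/andP; split; lra.
  - by rewrite /B radius_ball_num ?(ltW (r0 _))// /r abE/=; lra.
have rB0 k : (0 < (radius (B k))%:num)%R by rewrite radius_ball_num// ltW.
have [D [cD DV tD AD]] := vitali_theorem rB0 vit.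
pose F k := if k \in D then `[(ab k).1, (ab k).2]%classic else set0.
pose H k := if k \in D then `]h (ab k).1, h (ab k).2[%classic else set0.
have mF k : measurable (F k) by rewrite /F; case: ifP.
have mH k : measurable (H k) by rewrite /H; case: ifP.
have FD k : k \in D -> F k = closure (B k) by rewrite /F => ->; rewrite clB.
have UE : \bigcup_(k in D) closure (B k) = \bigcup_k F k.
  apply/seteqP; split=> x [k Dk]; first by move=> ?; exists k => //;
    rewrite FD// inE.
  have [kD|kD] := boolP (k \in D); last by rewrite /F (negbTE kD).
  by rewrite FD// => ?; exists k => //; rewrite -inE.
have okD k : k \in D -> ok (ab k) by rewrite inE => /DV.
have tF : trivIset setT F.
  move=> i j _ _ [x [Fi Fj]].
  have [iD|iD] := boolP (i \in D); last by move: Fi; rewrite /F (negbTE iD).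
  have [jD|jD] := boolP (j \in D); last by move: Fj; rewrite /F (negbTE jD).
  by apply: tD; [rewrite -inE|rewrite -inE|exists x; split; rewrite /= -FD].
(* Disjoint intervals are ordered and [h] preserves the order. The images are taken open because
   neighbouring ones may share an endpoint. *)
have tH : trivIset setT H.
  move=> i j _ _ [x [Hi Hj]].
  have [iD|iD] := boolP (i \in D); last by move: Hi; rewrite /H (negbTE iD).
  have [jD|jD] := boolP (j \in D); last by move: Hj; rewrite /H (negbTE jD).
  apply: contrapT => /eqP ij.
  have dF : F i `&` F j = set0 by move/trivIsetP : tF; apply.
  move: Hi Hj; rewrite /H iD jD/= !in_itv/= => /andP[ix xi] /andP[jx xj].
  have [i0 i12 i1 _] := okD _ iD; have [j0 j12 j1 _] := okD _ jD.
  have [bi|ib] := leP (ab i).2 (ab j).1.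
    by have := ndh _ _ (le_trans i0 (ltW i12)) bi (le_trans (ltW j12) j1); lra.
  have [bj|jb] := leP (ab j).2 (ab i).1.
    by have := ndh _ _ (le_trans j0 (ltW j12)) bj (le_trans (ltW i12) i1); lra.
  suff : (F i `&` F j) (Num.max (ab i).1 (ab j).1) by rewrite dF.
  rewrite /F iD jD /= !in_itv/=; split; rewrite le_max lexx ?orbT/= ge_max.
    by rewrite (ltW i12) (ltW ib).
  by rewrite (ltW jb) (ltW j12).
have mU : measurable (\bigcup_k F k) by exact: bigcupT_measurable.
have mUH : measurable (\bigcup_k H k) by exact: bigcupT_measurable.
pose Z := `[0%R, 1%R]%classic `\` \bigcup_k F k.
have mZ : measurable Z by exact: measurableD.
have Z0 : mu Z = 0.
  apply/(@negligibleP _ _ _ mu _ mZ).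
  apply: (@negligibleS _ _ _ mu (N `|` [set 0%R] `|` [set 1%R] `|`
      (A `\` \bigcup_k F k))).
    move=> x [/=]; rewrite in_itv/= => /andP[x0 x1] Fx.
    have [Nx|Nx] := pselect (N x); first by left; left; left.
    have [->|xn0] := eqVneq x 0%R; first by left; left; right.
    have [->|xn1] := eqVneq x 1%R; first by left; right.
    by right; split=> //; split=> //=;
      rewrite in_itv/= !lt_neqAle eq_sym xn0 x0 xn1.
  apply: negligibleU; first apply: negligibleU; first apply: negligibleU.
  - by exists N; split.
  - by apply/(negligibleP mu (measurable_set1 _)); exact: lebesgue_measure_set1.
  - by apply/(negligibleP mu (measurable_set1 _)); exact: lebesgue_measure_set1.
  - apply/negligibleP; last by rewrite -UE.
    by apply: measurableD => //; exact: measurableD.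
rewrite (@ge0_negligible_integral _ _ _ mu _ Z)//; last exact: mpE.
apply: (@le_trans _ _ (\int[mu]_(x in \bigcup_k F k) (p x)%:E)).
  apply: ge0_subset_integral => //; [exact: measurableD|exact: mpE|].
  by move=> x [x01 /not_andP[//|/contrapT]].
rewrite ge0_integral_bigcup//; last exact: mpE.
(* The sets [H k] are disjoint in [[h 0, h 1]] and the [F k] disjoint in [[0, 1]], so the two sums
   are at most [h 1 - h 0] and [2 * e]. *)
apply: (@le_trans _ _ (\sum_(k <oo) (mu (H k) + (2 * e)%:E * mu (F k)))).
  apply: lee_nneseries => k _; first by move=> ?; apply: integral_ge0.
  rewrite /H /F; case: ifPn => kD;
    last by rewrite integral_set0 measure0 mule0 adde0.
  have [k0 k12 k1 kP] := okD _ kD.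
  rewrite !lebesgue_measure_itv/= !lte_fin k12.
  have hk : (h (ab k).1 <= h (ab k).2)%R by apply: ndh => //; exact: ltW.
  move: hk; rewrite le_eqVlt => /orP[/eqP hk|hk].
    by rewrite hk ltxx add0e (le_trans kP)// hk subrr add0r EFinM EFinB.
  by rewrite hk (le_trans kP)// EFinD EFinM !EFinB.
rewrite nneseriesD//; last first.
  by move=> k _; rewrite mule_ge0// lee_fin mulr_ge0// ltW.
rewrite nneseriesZl//.
rewrite EFinD; apply: leeD.
  rewrite -measure_semi_bigcup//.
  apply: (@le_trans _ _ (mu `[h 0%R, h 1%R])).
    apply: le_measure; rewrite ?inE// => x [k _].
    rewrite /H; case: ifPn => // kD; rewrite /= !in_itv/= => /andP[hx xh].
    have [k0 k12 k1 kP] := okD _ kD.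
    have := ndh _ _ (lexx 0) k0 (le_trans (ltW k12) k1).
    have := ndh _ _ (le_trans k0 (ltW k12)) k1 (lexx _).
    by move=> ? ?; apply/andP; split; lra.
  have h01 : (h 0%R <= h 1%R)%R by apply: ndh.
  rewrite lebesgue_measure_itv/= lte_fin; case: ifP => _; first by rewrite EFinB.
  by rewrite lee_fin subr_ge0.
rewrite -[leRHS]mule1 lee_pmul2l// ?lte_fin ?mulr_gt0//.
rewrite -measure_semi_bigcup//.
apply: (@le_trans _ _ (mu `[0%R, 1%R])).
  apply: le_measure; rewrite ?inE// => x [k _].
  rewrite /F; case: ifPn => // kD; rewrite /= !in_itv/= => /andP[hx xh].
  by have [k0 k12 k1 kP] := okD _ kD; apply/andP; split; lra.
by rewrite lebesgue_measure_itv/= lte_fin ltr01 -EFinB subr0.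
Qed.

End growth.

(** * Locality for two monotone functions on [[0, 1]] *)

Section locality_on_the_line.
Local Open Scope ereal_scope.
Context {R : realType}.
Notation mu := (@lebesgue_measure R).

Lemma measurable_fun_if_mem d d' (T : measurableType d) (U : measurableType d')
    (A : set T) (g h : T -> U) : measurable A ->
  measurable_fun setT g -> measurable_fun setT h ->
  measurable_fun setT (fun x => if x \in A then g x else h x).
Proof.
move=> mA mg mh; apply: measurable_fun_ifT => //.
apply: (measurable_fun_bool true); rewrite setTI.
suff -> : (fun x => x \in A) @^-1` [set true] = A by [].
by apply/seteqP; split=> x /= => [/set_mem//|]; exact: mem_set.
Qed.

Lemma esub_fin (x y : R) : esub x%:E y%:E = (x - y)%:E.
Proof. by []. Qed.

Lemma le_esub (x x' y y' : \bar R) : x <= x' -> y' <= y ->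
  esub x y <= esub x' y'.
Proof.
move: x x' y y' => [x| |] [x'| |] [y| |] [y'| |]//=;
  rewrite ?lee_fin ?leey ?leNye//.
by move=> ? ?; lra.
Qed.

Lemma esub_ge0 (x y : \bar R) : y <= x -> 0 <= esub x y.
Proof.
by move: x y => [x| |] [y| |]//=; rewrite ?lee_fin ?leey// subr_ge0.
Qed.

(** Monotone convergence. Truncated densities are bounded, which the Lebesgue point and covering
    arguments require. *)
Lemma le_integral_truncated d (T : measurableType d)
    (m : {measure set T -> \bar R}) (D : set T) (f : T -> \bar R) (c : \bar R) :
  measurable D -> measurable_fun setT f -> (forall x, 0 <= f x) ->
  (forall n : nat, \int[m]_(x in D) mine (f x) n%:R%:E <= c) ->
  \int[m]_(x in D) f x <= c.
Proof.
move=> mD mf f0 fc.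
have lf x : limn (fun n => mine (f x) n%:R%:E) = f x.
  apply/cvg_lim => //; case: (f x) (f0 x) => [r| |]//= r0.
    apply: cvg_near_cst; near=> n; apply/min_idPl; rewrite lee_fin.
    by near: n; exact: nbhs_infty_ger.
  have -> : (fun n => mine +oo n%:R%:E) = (fun n => n%:R%:E) :> (nat -> \bar R).
    by apply/funext => n; apply/min_idPr; rewrite leey.
  exact/cvgeryP/cvgr_idn.
rewrite (_ : \int[m]_(x in D) f x =
    \int[m]_(x in D) limn (fun n => mine (f x) n%:R%:E)); last first.
  by apply: eq_integral => x _; rewrite lf.
have mg n : measurable_fun D (fun x => mine (f x) n%:R%:E).
  by apply: measurable_mine => //; exact: measurable_funTS.
have g0 n x : D x -> 0 <= mine (f x) n%:R%:E.
  by move=> _; rewrite le_min f0 lee_fin ler0n.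
have nd x : D x ->
    {homo (fun n => mine (f x) n%:R%:E) : n k / (n <= k)%N >-> n <= k}.
  move=> _ n k nk; rewrite le_min ge_min lexx/= ge_min lee_fin ler_nat nk.
  by rewrite orbT.
have H := @cvg_monotone_convergence _ _ _ m _ mD _ mg g0 nd.
rewrite -(cvg_lim (@ereal_hausdorff R) H); apply: lime_le; last exact: nearW.
by apply/cvg_ex; eexists; exact: H.
Unshelve. all: by end_near. Qed.

Lemma locally_integrable_bounded (p : R -> R) (n : R) :
  measurable_fun setT p -> (forall x, 0 <= p x <= n)%R ->
  locally_integrable setT p.
Proof.
move=> mp pn; split => //; first exact: openT.
move=> K _ cK; have mK := compact_measurable cK.
have : mu.-integrable K (EFin \o p).
  apply: measurable_bounded_integrable => //.
  - exact: compact_finite_measure.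
  - exact: measurable_funTS.
  - exists n; split=> [|M nM x _]; first exact: num_real.
    by rewrite /= ger0_norm; have /andP[p0 pxn] := pn x => //; lra.
by case/integrableP.
Qed.


(** Shrinking [[s, t]] slightly to a rational interval does not increase the increment of the
    monotone [g], and the bound on [p] makes the lost part of the integral at most [e]. *)
Lemma integral_itv_le_of_rational (p : R -> R) (n : R) (g : R -> \bar R) :
  measurable_fun setT p -> (forall x, 0 <= p x <= n)%R ->
  (forall x y : R, (0 <= x)%R -> (x <= y)%R -> (y <= 1)%R -> g x <= g y) ->
  (forall a b : rat, (0 <= (ratr a : R))%R -> ((ratr a : R) < ratr b)%R ->
    ((ratr b : R) <= 1)%R ->
    \int[mu]_(x in `[ratr a, ratr b]) (p x)%:E <=
      esub (g (ratr b)) (g (ratr a))) ->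
  forall s t, (0 <= s)%R -> (s < t)%R -> (t <= 1)%R ->
    \int[mu]_(x in `[s, t]) (p x)%:E <= esub (g t) (g s).
Proof.
move=> mp pn ndg gab s t s0 st t1.
have n0 : (0 <= n)%R by have /andP[] := pn 0%R; exact: le_trans.
apply/lee_addgt0Pr => e e0.
pose c := (e / (2 * (n + 1)))%R.
have c0 : (0 < c)%R by rewrite divr_gt0// mulr_gt0//; lra.
have nc : (n * c + n * c <= e)%R.
  have -> : (n * c + n * c = e * (n / (n + 1)))%R by rewrite /c; field; lra.
  by rewrite ler_piMr ?(ltW e0)// ler_pdivrMr; lra.
clearbody c.
(* The midpoint of [[s, t]] separates [a] from [b]. *)
have h1 : (s < Num.min (s + c) ((s + t) / 2))%R.
  by rewrite lt_min; apply/andP; split; lra.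
have [a] := rat_in_itvoo h1.
rewrite in_itv/= lt_min => /and3P[sa asc ast].
have h2 : (Num.max (t - c) ((s + t) / 2) < t)%R.
  by rewrite gt_max; apply/andP; split; lra.
have [b] := rat_in_itvoo h2.
rewrite in_itv/= gt_max => /andP[/andP[tcb stb] bt].
have a0 : (0 <= (ratr a : R))%R by lra.
have b1 : ((ratr b : R) <= 1)%R by lra.
have ab : ((ratr a : R) < ratr b)%R by lra.
have := gab _ _ a0 ab b1.
move: (ratr a : R) (ratr b : R) {h1 h2} =>
  {}a {}b in sa asc ast tcb stb bt a0 b1 ab *.
move=> abP.
apply: (le_trans (integral_itv_split_le mp pn (ltW sa) (ltW ab) (ltW bt))).
have q1 : (n * (a - s) <= n * c)%R by rewrite ler_wpM2l//; lra.
have q2 : (n * (t - b) <= n * c)%R by rewrite ler_wpM2l//; lra.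
rewrite addeCA; apply: leeD; last by rewrite -EFinD lee_fin; lra.
apply: (le_trans abP); apply: le_esub; apply: ndg; lra.
Qed.

(* As g1 - g2 maps B into a null set, for almost every t in B its difference
   quotients between t and points y of B decreasing to t accumulate at 0, so
   that g1 and g2 have almost the same increments along some such y. *)
Theorem integral_locality (g1 g2 w1 w2 : R -> \bar R)
    (B : set R) (E : set (measurableTypeR R)) :
  (forall x y : R, (0 <= x)%R -> (x <= y)%R -> (y <= 1)%R -> g1 x <= g1 y) ->
  (forall x y : R, (0 <= x)%R -> (x <= y)%R -> (y <= 1)%R -> g2 x <= g2 y) ->
  measurable_fun setT w1 -> (forall x, 0 <= w1 x) ->
  measurable_fun setT w2 -> (forall x, 0 <= w2 x) ->
  (forall a b : rat, (0 <= (ratr a : R))%R -> ((ratr a : R) < ratr b)%R ->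
    ((ratr b : R) <= 1)%R ->
    \int[mu]_(x in `[ratr a, ratr b]) w1 x <= esub (g1 (ratr b)) (g1 (ratr a))) ->
  (forall a b : rat, (0 <= (ratr a : R))%R -> ((ratr a : R) < ratr b)%R ->
    ((ratr b : R) <= 1)%R ->
    \int[mu]_(x in `[ratr a, ratr b]) w2 x <= esub (g2 (ratr b)) (g2 (ratr a))) ->
  measurable B -> mu E = 0 ->
  (forall t, B t -> (EFin @` E) (esub (g1 t) (g2 t))) ->
  \int[mu]_(t in `[0%R, 1%R]) (if t \in B then w1 t else w2 t) <=
    esub (g2 1%R) (g2 0%R).
Proof.
move=> nd1 nd2 mw1 w10 mw2 w20 gw1 gw2 mB E0 BE.
(* In these two cases the conventions of [esub] give [+oo] on the right. Otherwise monotonicity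
   makes [g2] finite on all of [[0, 1]]. *)
have [->|g21] := eqVneq (g2 1%R) +oo; first by case: (g2 0%R) => *; rewrite leey.
have [->|g20] := eqVneq (g2 0%R) -oo; first by case: (g2 1%R) => *; rewrite leey.
pose h2 t := fine (g2 t); pose h1 t := fine (g1 t).
have g2E t : (0 <= t <= 1)%R -> g2 t = (h2 t)%:E.
  move=> /andP[t0 t1]; rewrite fineK// fin_numE; apply/andP; split.
    by apply: contra g20 => /eqP tE; rewrite -leeNy_eq -tE; apply: nd2.
  by apply: contra g21 => /eqP tE; rewrite -leye_eq -tE; apply: nd2.
(* [g1] may be infinite off [B]; on [B] a real value of [esub] forces both arguments to be real. *)
have g1E t : B t -> (0 <= t <= 1)%R -> g1 t = (h1 t)%:E.
  by move=> /BE [r Er]; rewrite /h1; case: (g1 t) (g2 t) => [?| |] [?| |].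
have uE t : B t -> (0 <= t <= 1)%R -> E (h1 t - h2 t)%R.
  move=> Bt t01; have [r Er] := BE _ Bt.
  by rewrite (g1E _ Bt t01) (g2E _ t01) => -[<-].
have ndh2 x y : (0 <= x -> x <= y -> y <= 1 -> h2 x <= h2 y)%R.
  move=> x0 xy y1; have := nd2 _ _ x0 xy y1.
  by rewrite !g2E ?lee_fin//; apply/andP; split; lra.
rewrite !g2E ?lexx ?ler01// esub_fin.
apply: le_integral_truncated => //.
- exact: measurable_fun_if_mem.
- by move=> x; case: ifP.
move=> n; apply/lee_addgt0Pr => e' e'0.
(* Each short interval has three errors of rate at most [e]: from the Lebesgue point of [p], from
   that of [p1] or [p2], and from the increment of [u]. The covering lemma doubles their sum. *)
pose e := (e' / 6)%R; have e0 : (0 < e)%R by rewrite divr_gt0.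
pose p1 t := fine (mine (w1 t) n%:R%:E); pose p2 t := fine (mine (w2 t) n%:R%:E).
have trunc (y : \bar R) : 0 <= y -> (fine (mine y n%:R%:E))%:E = mine y n%:R%:E.
  move=> y0; rewrite fineK// ge0_fin_numE ?le_min ?y0 ?lee_fin ?ler0n//.
  by rewrite gt_min ltry orbT.
have truncn (y : \bar R) : 0 <= y -> (0 <= fine (mine y n%:R%:E) <= n%:R)%R.
  move=> y0; rewrite -!lee_fin trunc// le_min y0 lee_fin ler0n/= ge_min lexx.
  by rewrite orbT.
have mtrunc (w : R -> \bar R) : measurable_fun setT w ->
    measurable_fun setT (fun t => fine (mine (w t) n%:R%:E)).
  move=> mw; apply: (@measurableT_comp _ _ _ _ _ _ fine) => //.
  exact: measurable_mine.
have mp1 : measurable_fun setT p1 by exact: mtrunc.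
have mp2 : measurable_fun setT p2 by exact: mtrunc.
have p1n x : (0 <= p1 x <= n%:R)%R by exact: truncn.
have p2n x : (0 <= p2 x <= n%:R)%R by exact: truncn.
pose p t := if t \in B then p1 t else p2 t.
have mp : measurable_fun setT p by exact: measurable_fun_if_mem.
have pn x : (0 <= p x <= n%:R)%R by rewrite /p; case: ifP.
have -> : \int[mu]_(x in `[0%R, 1%R])
    mine (if x \in B then w1 x else w2 x) n%:R%:E =
    \int[mu]_(x in `[0%R, 1%R]) (p x)%:E.
  by apply: eq_integral => x _; rewrite /p /p1 /p2; case: ifP; rewrite trunc.
have bnd (w g : R -> \bar R) : measurable_fun setT w -> (forall x, 0 <= w x) ->
    (forall x y : R, (0 <= x)%R -> (x <= y)%R -> (y <= 1)%R -> g x <= g y) ->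
    (forall a b : rat, (0 <= (ratr a : R))%R -> ((ratr a : R) < ratr b)%R ->
      ((ratr b : R) <= 1)%R ->
      \int[mu]_(x in `[ratr a, ratr b]) w x <= esub (g (ratr b)) (g (ratr a))) ->
    forall s t, (0 <= s)%R -> (s < t)%R -> (t <= 1)%R ->
    \int[mu]_(x in `[s, t]) (fine (mine (w x) n%:R%:E))%:E <= esub (g t) (g s).
  move=> mw w0 ndg gw; apply: (@integral_itv_le_of_rational _ n%:R) => //.
  - exact: mtrunc.
  - by move=> x; exact: truncn.
  - move=> a b a0 ab b1; apply: le_trans (gw _ _ a0 ab b1).
    apply: ge0_le_integral => //.
    + by move=> x _; have /andP[] := truncn _ (w0 x); rewrite lee_fin.
    + by apply/measurable_EFinP; apply: measurable_funTS; exact: mtrunc.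
    + exact: measurable_funTS.
    + by move=> x _; rewrite trunc// ge_min lexx.
have b1 := bnd _ _ mw1 w10 nd1 gw1; have b2 := bnd _ _ mw2 w20 nd2 gw2.
pose u t := (h1 t - h2 t)%R.
(* On [S m] the quotients of [u] towards later points of [B] stay at least [e] at scale
   [1 / (m + 1)]. A point of [B] with no later point of [B] that close belongs to [S m] vacuously,
   so outside these sets the wanted [y] exists. *)
pose S m := [set t | [/\ (0 <= t <= 1)%R, B t & forall y, B y -> (t < y <= 1)%R ->
  (y < t + m.+1%:R^-1)%R -> (e * (y - t) <= `|u y - u t|)%R]].
have negS : mu.-negligible (\bigcup_m S m).
  apply: negligible_bigcup => m.
  apply: (@negligible_locally_expanding _ u E _ e m.+1%:R^-1) => //.
    by move=> x [/[dup] x01 /andP[x0 x1] Bx _]; split=> //; exact: uE.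
  move=> x y [_ _ Sx] [/andP[_ y1] By _] /andP[xy yxm].
  by apply: Sx => //; rewrite xy.
have aeS : {ae mu, forall t, ~ (\bigcup_m S m) t}.
  by apply: negligibleS negS => t /= /contrapT.
have L := lebesgue_differentiation (locally_integrable_bounded mp pn).
have L1 := lebesgue_differentiation (locally_integrable_bounded mp1 p1n).
have L2 := lebesgue_differentiation (locally_integrable_bounded mp2 p2n).
have -> : ((h2 1 - h2 0)%:E + e'%:E = (h2 1 - h2 0 + 2 * (3 * e))%:E)%R.
  by rewrite -EFinD /e; congr EFin; field.
apply: (@le_integral_itv_of_fine_cover _ _ _ n%:R) => //; first by lra.
have FF : Filter (nbhs (almost_everywhere mu)).
  exact: ae_filter_ringOfSetsType.
apply: filterS2 (filterI L aeS) (filterI L1 L2) => t [Lt St] [L1t L2t].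
move=> /andP[t0 t1] r r0.
have [r1 r10 R1] := lebesgue_pt_right mp (fun x => proj1 (andP (pn x))) Lt e0.
have [r2 r20 R2] := lebesgue_pt_right mp1 (fun x => proj1 (andP (p1n x))) L1t e0.
have [r3 r30 R3] := lebesgue_pt_right mp2 (fun x => proj1 (andP (p2n x))) L2t e0.
have key y (q : R) : (t < y)%R -> (y < t + r1)%R -> p t = q ->
    ((q - e) * (y - t) <= h2 y - h2 t + e * (y - t))%R ->
    \int[mu]_(x in `[t, y]) (p x)%:E <= (h2 y - h2 t + 3 * e * (y - t))%:E.
  move=> ty yr pq qh; have /R1[_ /le_trans] : (t < y < t + r1)%R by rewrite ty.
  by apply; rewrite lee_fin pq; lra.
pose d := (Num.min (Num.min r (1 - t)) (Num.min r1 (Num.min r2 r3)))%R.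
have d0 : (0 < d)%R by rewrite !lt_min r0 r10 r20 r30 subr_gt0 t1.
have dP y : (y < t + d)%R ->
    [/\ (y < t + r)%R, (y < 1)%R, (y < t + r1)%R,
      (y < t + r2)%R & (y < t + r3)%R].
  by rewrite -ltrBlDl !lt_min => /andP[/andP[? ?]] /and3P[? ? ?]; split; lra.
clearbody d.
have t01 : (0 <= t <= 1)%R by rewrite !ltW.
have [Bt|Bt] := pselect (B t).
  have [m md] : exists m, (m.+1%:R^-1 < d)%R.
    by exists (Num.truncn d^-1); rewrite invf_plt ?posrE// truncnS_gt.
  have : ~ S m t by move=> Smt; apply: St; exists m.
  move=> Smt; have : exists y, [/\ B y, (t < y <= 1)%R, (y < t + m.+1%:R^-1)%R &
      (`|u y - u t| < e * (y - t))%R].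
    apply: contrapT => /forallNP H; apply: Smt; split=> // y By ty ym.
    by rewrite leNgt; apply/negP => uy; apply: (H y).
  move=> [y [By /andP[ty y1] ym uy]].
  have ytd : (y < t + d)%R by rewrite (lt_trans ym)// ltrD2l.
  have [yr _ yr1 yr2 yr3] := dP y ytd.
  have y01 : (0 <= y <= 1)%R by rewrite y1 andbT; lra.
  exists y; first by rewrite ty.
  apply: (key y (p1 t)) => //; first by rewrite /p mem_set.
  have /R2[/le_trans + _] : (t < y < t + r2)%R by rewrite ty.
  move=> /(_ _ (b1 _ _ (ltW t0) ty y1)).
  rewrite (g1E _ Bt t01) (g1E _ By y01) esub_fin lee_fin => h1P.
  by move: uy; rewrite /u ltr_norml => /andP[? ?]; lra.
(* Off [B] every [y] close to [t] works, since [p] is [p2] at [t] and [g2] bounds the integral of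
   [p2] directly. *)
have [yr y1 yr1 yr2 yr3] := dP (t + d / 2)%R ltac:(lra).
have ty : (t < t + d / 2)%R by lra.
exists (t + d / 2)%R; first by rewrite ty.
apply: (key _ (p2 t)) => //; first by rewrite /p memNset.
have /R3[/le_trans + _] : (t < t + d / 2 < t + r3)%R by rewrite ty.
move=> /(_ _ (b2 _ _ (ltW t0) ty (ltW y1))).
rewrite !g2E//; last by apply/andP; split; lra.
rewrite esub_fin lee_fin => h2P.
have : (0 <= e * (t + d / 2 - t))%R by rewrite mulr_ge0 ?ltW//; lra.
lra.
Qed.

End locality_on_the_line.

(** * Restriction of curves and their causal speed *)

Section affine_substitution.
Local Open Scope ereal_scope.
Context {R : realType}.
Notation mu := (@lebesgue_measure R).

Definition pushforward_measure d d' (T1 : measurableType d)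
    (T2 : measurableType d') (m : {measure set T1 -> \bar R}) (f : T1 -> T2)
    (mf : measurable_fun setT f) : {measure set T2 -> \bar R} :=
  measure_function_pushforward__canonical__measure_function_Measure m mf.

Definition affine (s t : R) (r : R) : R := (s + (t - s) * r)%R.

Lemma measurable_affine (s t : R) :
  measurable_fun setT (affine s t : measurableTypeR R -> measurableTypeR R).
Proof. by apply: measurable_funD => //; apply: measurable_funM. Qed.

(** The rescaled push-forward agrees with Lebesgue measure on half-open intervals, and these
    determine it. *)
Lemma lebesgue_measure_affine (s t : R) (A : set (measurableTypeR R)) :
  (s < t)%R -> measurable A ->
  mu A = (t - s)%:E * mu (affine s t @^-1` A).
Proof.
move=> st mA; have k0 : (0 <= t - s)%R by lra.
pose m := mscale (NngNum k0) (pushforward_measure mu (measurable_affine s t)).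
have -> : (t - s)%:E * mu (affine s t @^-1` A) = m A by [].
apply: lebesgue_measure_unique => // _ [[a b]] _ <-.
rewrite /m /mscale/= /pushforward.
transitivity ((t - s)%:E * mu `]((a - s) / (t - s))%R, ((b - s) / (t - s))%R]).
  rewrite !lebesgue_measure_itv/= !lte_fin ltr_pM2r ?invr_gt0 ?subr_gt0//.
  rewrite ltrD2r; case: ifPn => _; last by rewrite mule0.
  by rewrite -!EFinB -EFinM; congr EFin; field; lra.
congr (_ * mu _); apply/seteqP; split=> x; rewrite /= !in_itv/= /affine.
  by rewrite ltr_pdivrMr ?ler_pdivlMr ?subr_gt0// => /andP[? ?]; apply/andP;
    split; lra.
by rewrite ltr_pdivrMr ?ler_pdivlMr ?subr_gt0// => /andP[? ?]; apply/andP;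
  split; lra.
Qed.

Lemma integral_affine (s t : R) (A : set (measurableTypeR R)) (f : R -> \bar R) :
  (s < t)%R -> measurable A -> measurable_fun setT f -> (forall x, 0 <= f x) ->
  \int[mu]_(r in affine s t @^-1` A) ((t - s)%:E * f (affine s t r)) =
  \int[mu]_(r in A) f r.
Proof.
move=> st mA mf f0; have k0 : (0 <= t - s)%R by lra.
have mpA : measurable (affine s t @^-1` A).
  by rewrite -[X in measurable X]setTI; exact: measurable_affine.
pose m := mscale (NngNum k0) (pushforward_measure mu (measurable_affine s t)).
rewrite [RHS](@eq_measure_integral _ _ _ _ m mu); last first.
  by move=> B mB _; exact: lebesgue_measure_affine.
rewrite ge0_integral_mscale//; last exact: measurable_funTS.
rewrite (ge0_integral_pushforward (measurable_affine s t))//;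
  last exact: measurable_funTS.
rewrite ge0_integralZl//; apply: measurable_funTS.
by apply: measurableT_comp => //; exact: measurable_affine.
Qed.

Lemma null_affine (s t : R) (A : set (measurableTypeR R)) :
  (s < t)%R -> measurable A -> mu (affine s t @^-1` A) = 0 <-> mu A = 0.
Proof.
move=> st mA; rewrite (lebesgue_measure_affine st mA).
split=> [->|/eqP]; first by rewrite mule0.
by rewrite mule_eq0 eqe subr_eq0 gt_eqF//= => /eqP.
Qed.

(** For rational [q], the points [t > q] with []q, t]] inside [P] form an interval, and these
    countably many intervals exhaust [P]. This is the source of all measurability in time of
    left-continuous curves. *)
Lemma left_itv_measurable (P : set R) :
  (forall t, P t -> exists2 e : R, (0 < e)%R & forall u, (t - e < u <= t)%R ->
    P u) ->
  measurable P.
Proof.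
move=> Ple.
pose Q (q : rat) := [set t : R | (ratr q < t)%R /\ forall u,
  (ratr q < u <= t)%R -> P u].
rewrite (_ : P = \bigcup_q Q q).
  apply: bigcupT_measurable_rat => q; apply: is_interval_measurable.
  move=> x y /= [qx Px] [qy Py] z /andP[xz zy]; split;
    first exact: lt_le_trans xz.
  by move=> u /andP[qu uz]; apply: Py; rewrite qu (le_trans uz).
apply/seteqP; split=> [t Pt|t [q _ [qt Pq]]]; last by apply: Pq; rewrite qt lexx.
have [e e0 eP] := Ple _ Pt.
have /rat_in_itvoo[q] : (t - e < t)%R by lra.
rewrite in_itv/= => /andP[eq qt]; exists q => //; split=> // u /andP[qu ut].
by apply: eP; rewrite ut (lt_trans eq).
Qed.

End affine_substitution.

(** * Restriction of a curve to [[s, t]], reparametrized on [[0, 1]] *)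

Section restricted_curves.
Context {R : realType} (M : mm_spacetime R).
Implicit Types g : lcc M.

(** The constant extension outside [[0, 1]] gives left continuity at every real time. *)
Lemma lcc_left_nbhs g (t : R) (U : set M) : nbhs (g t) U ->
  exists2 e : R, 0 < e & forall u, t - e < u <= t -> U (g u).
Proof.
move=> Ut; have [t0|t0] := leP t 0.
  exists 1 => // u /andP[_ ut].
  rewrite lcc_constant_left ?(le_trans ut)// -(lcc_constant_left g t0).
  exact: nbhs_singleton.
have [t1|t1] := leP t 1.
  have /(_ U Ut) [e /= e0 eU] := @lcc_left_continuous _ _ g t t0 t1.
  exists e => // u /andP[teu]; rewrite le_eqVlt => /orP[/eqP ->|ut].
    exact: nbhs_singleton.
  apply: eU => //=; rewrite ger0_norm ?subr_ge0 ?ltW//; lra.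
exists (t - 1); first by rewrite subr_gt0.
move=> u /andP[tu ut]; rewrite lcc_constant_right; last by lra.
by rewrite -(lcc_constant_right g (ltW t1)); exact: nbhs_singleton.
Qed.

Lemma measurable_lcc g :
  measurable_fun setT (g : measurableTypeR R -> borel M).
Proof.
apply: (@measurability _ _ (measurableTypeR R) (borel M) _ _ (@open M)) => //.
move=> _ [U oU <-]; rewrite setTI.
apply: left_itv_measurable => t Ut; apply: lcc_left_nbhs.
exact: open_nbhs_nbhs.
Qed.

Lemma measurable_comp_lcc (G : M -> \bar R) g :
  measurable_fun setT (G : borel M -> \bar R) ->
  measurable_fun setT (fun t : R => G (g t)).
Proof. by move=> mG; exact: (measurableT_comp mG (measurable_lcc g)). Qed.

(** Clamping makes restricted curves constant outside [[0, 1]], as the encoding of [lcc] demands. *)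
Definition clamp01 (r : R) : R := Num.max 0 (Num.min r 1).

Lemma clamp01_id (r : R) : 0 <= r <= 1 -> clamp01 r = r.
Proof. by move=> /andP[r0 r1]; rewrite /clamp01 min_l// max_r. Qed.

Lemma clamp01_itv (r : R) : 0 <= clamp01 r <= 1.
Proof. by rewrite /clamp01 le_max lexx/= ge_max ler01/= ge_min lexx orbT. Qed.

Lemma clamp01_le (r r' : R) : r <= r' -> clamp01 r <= clamp01 r'.
Proof.
move=> rr'; rewrite /clamp01 ge_max le_max lexx/= le_max; apply/orP; right.
by rewrite le_min !ge_min rr' lexx orbT.
Qed.

Lemma affine_itv (s t r : R) : s < t -> 0 <= r <= 1 -> s <= affine s t r <= t.
Proof.
move=> st /andP[r0 r1]; rewrite /affine; apply/andP; split.
  by rewrite lerDl mulr_ge0// subr_ge0 ltW.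
by rewrite -lerBrDl -[leRHS]mulr1 ler_wpM2l// subr_ge0 ltW.
Qed.

Lemma preimage_affine_itv (s t : R) : s < t ->
  affine s t @^-1` `[s, t] = `[0, 1]%classic.
Proof.
move=> st; have ts0 : 0 < t - s by rewrite subr_gt0.
apply/seteqP; split=> r; rewrite /= !in_itv/= /affine => /andP[r0 r1].
  apply/andP; split; first by rewrite -(pmulr_rge0 _ ts0); lra.
  by rewrite -(ler_pM2l ts0) mulr1; lra.
by apply: affine_itv; rewrite ?r0.
Qed.

Section restriction.
Variables (g : lcc M) (s t : R).
Hypothesis st : [/\ 0 <= s, s < t & t <= 1].

Definition lcc_restrict_fun (r : R) : M := g (affine s t (clamp01 r)).

Lemma lcc_restrict_causal (a b : R) : 0 <= a -> a <= b -> b <= 1 ->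
  mms_le (lcc_restrict_fun a) (lcc_restrict_fun b).
Proof.
move=> a0 ab b1; have [s0 slt t1] := st.
have /andP[sa ta] := affine_itv slt (clamp01_itv a).
have /andP[sb tb] := affine_itv slt (clamp01_itv b).
apply: lcc_causal; [exact: le_trans sa| |exact: le_trans t1].
by rewrite lerD2l ler_wpM2l ?subr_ge0 ?(ltW slt)// clamp01_le.
Qed.

Lemma lcc_restrict_left_continuous (r : R) : 0 < r -> r <= 1 ->
  lcc_restrict_fun x @[x --> r^'-] --> lcc_restrict_fun r.
Proof.
move=> r0 r1 U /lcc_left_nbhs[e e0 eU]; have [s0 slt t1] := st.
have ts0 : 0 < t - s by lra.
have d0 : 0 < Num.min (e / (t - s)) r by rewrite lt_min divr_gt0.
exists (Num.min (e / (t - s)) r) => //= x.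
rewrite /ball_/= => + xr'; rewrite gtr0_norm ?subr_gt0// lt_min => /andP[xe xr].
apply: eU; rewrite !clamp01_id; [|lra|lra].
have {}xe : (r - x) * (t - s) < e.
  by rewrite -ltr_pdivlMr.
rewrite /affine lerD2l ler_wpM2l ?(ltW xr') ?(ltW ts0)// andbT.
by lra.
Qed.

Definition lcc_restrict : lcc M.
Proof.
apply: (@LCC _ _ lcc_restrict_fun).
- exact: lcc_restrict_causal.
- exact: lcc_restrict_left_continuous.
- move=> r r0; rewrite /lcc_restrict_fun /clamp01 min_l ?(le_trans r0)//.
  by rewrite min_l// max_l// maxxx.
- by move=> r r1; rewrite /lcc_restrict_fun /clamp01 min_r// minxx.
Defined.

Lemma lcc_restrictE (r : R) : 0 <= r <= 1 -> lcc_restrict r = g (affine s t r).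
Proof. by move=> r01; rewrite /= /lcc_restrict_fun clamp01_id. Qed.

End restriction.
End restricted_curves.

(** * Largest measure and causal speed of a restricted curve *)

Section speed_of_restrictions.
Local Open Scope ereal_scope.
Context {R : realType} (M : mm_spacetime R).
Implicit Types g : lcc M.
Notation mu := (@lebesgue_measure R).

Lemma ell_superadditive (x y z : M) : mms_le x y -> mms_le y z ->
  mms_ell x y + mms_ell y z <= mms_ell x z.
Proof.
rewrite /mms_le; have [_ _ /(_ x y z)] := mms_time_separation M.
move: (mms_ell x y) (mms_ell y z) (mms_ell x z) => [a| |] [b| |] c//=.
by rewrite (addeC b%:E) minxx.
Qed.

Lemma speed_admissible_itv g nu (a b : R) : speed_admissible g nu ->
  (0 <= a)%R -> (a <= b)%R -> (b <= 1)%R ->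
  nu `]a, b[%classic <= mms_ell (g a) (g b).
Proof.
move=> [_ gnu] a0; rewrite le_eqVlt => /orP[/eqP <- a1|]; last exact: gnu.
by rewrite set_itvoo0 measure0; exact: mms_le_refl.
Qed.

(** Written as an [affine] map so that the lemmas on [affine] apply to the inverse too. *)
Definition inv_affine (s t : R) : R -> R :=
    affine (- s / (t - s)) ((1 - s) / (t - s)).

Lemma inv_affineE (s t x : R) : (s < t)%R -> inv_affine s t x =
    ((x - s) / (t - s))%R.
Proof. by move=> st; rewrite /inv_affine /affine; field; lra. Qed.

Lemma inv_affineK (s t x : R) : (s < t)%R -> affine s t (inv_affine s t x) = x.
Proof. by move=> st; rewrite inv_affineE// /affine; field; lra. Qed.

Lemma affineK (s t x : R) : (s < t)%R -> inv_affine s t (affine s t x) = x.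
Proof. by move=> st; rewrite inv_affineE// /affine; field; lra. Qed.

Lemma affine_lt (s t x y : R) : (s < t)%R ->
  (affine s t x < affine s t y)%R = (x < y)%R.
Proof. by move=> st; rewrite ltrD2l ltr_pM2l// subr_gt0. Qed.

Lemma affine0 (s t : R) : affine s t 0 = s.
Proof. by rewrite /affine mulr0 addr0. Qed.

Lemma affine1 (s t : R) : affine s t 1 = t.
Proof. by rewrite /affine mulr1 addrC subrK. Qed.

Lemma measurable_preimage_affine (s t : R) (A : set (measurableTypeR R)) :
  measurable A -> measurable (affine s t @^-1` A : set (measurableTypeR R)).
Proof. by move=> mA; rewrite -[X in measurable X]setTI;
  exact: measurable_affine. Qed.

Section restriction.
Variables (g : lcc M) (s t : R).
Hypothesis st : [/\ (0 <= s)%R, (s < t)%R & (t <= 1)%R].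
Let slt : (s < t)%R. Proof. by case: st. Qed.

Let moo (a b : R) : measurable (`]a, b[%classic : set (measurableTypeR R)).
Proof. exact: measurable_itv. Qed.

Let mcst : measurable (~` `[s, t]%classic : set (measurableTypeR R)).
Proof. by apply: measurableC; exact: measurable_itv. Qed.

Let minv (A : set (measurableTypeR R)) : measurable A ->
  measurable (inv_affine s t @^-1` A : set (measurableTypeR R)).
Proof. exact: measurable_preimage_affine. Qed.

Section extension.
Variables nu nu' : {measure set (measurableTypeR R) -> \bar R}.

(* The endpoints are dropped: nu' may charge them arbitrarily. *)
Definition speed_replace : {measure set (measurableTypeR R) -> \bar R} :=
  measure_add
    (pushforward_measure (mrestr nu' (moo 0 1)) (measurable_affine s t))
    (mrestr nu mcst).

Lemma speed_replaceE A : speed_replace A =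
  nu' (affine s t @^-1` A `&` `]0%R, 1%R[) + nu (A `&` ~` `[s, t]%classic).
Proof. by rewrite /speed_replace /measure_add/= /msum big_ord_recl big_ord1. Qed.

(** This turns a competitor on the restricted curve into a competitor on [g], through which
    maximality of [nu] passes to the restriction. *)
Lemma speed_replace_admissible : speed_admissible g nu ->
  speed_admissible (lcc_restrict g st) nu' -> speed_admissible g speed_replace.
Proof.
move=> gnu gnu'; have [s0 _ t1] := st; split.
  rewrite speed_replaceE; set A1 := (X in nu' X); set A2 := (X in nu X).
  have -> : A1 = set0.
    apply/seteqP; split=> // r [/=]; rewrite in_itv/= => rn.
    rewrite in_itv/= => /andP[r0 r1]; apply: rn.
    have /andP[? ?] : (s <= affine s t r <= t)%R by apply: affine_itv;
      rewrite ?ltW.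
    by apply/andP; split; lra.
  rewrite measure0 add0e; apply/eqP; rewrite eq_le measure_ge0 andbT -gnu.1.
  apply: le_measure; rewrite ?inE//; last 1 first.
  - exact: subIsetl.
  - by apply: measurableI => //; apply: measurableC; exact: measurable_itv.
  - by apply: measurableC; exact: measurable_itv.
move=> a b a0 ab b1; rewrite speed_replaceE.
(* These are [s] and [t] clamped to [[a, b]]. [nu] controls the two outer pieces, [nu'] the middle
   one, and superadditivity of [mms_ell] along the curve adds the three bounds. *)
pose x1 := Num.max a (Num.min b s); pose x2 := Num.max a (Num.min b t).
have ax1 : (a <= x1)%R by rewrite le_max lexx.
have x12 : (x1 <= x2)%R.
  rewrite ge_max !le_max lexx/=; apply/orP; right.
  by rewrite le_min !ge_min lexx (ltW slt) orbT.
have x2b : (x2 <= b)%R by rewrite ge_max (ltW ab) ge_min lexx.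
have P1 : nu `]a, x1[%classic <= mms_ell (g a) (g x1).
  by apply: speed_admissible_itv => //; lra.
have P2 : nu `]x2, b[%classic <= mms_ell (g x2) (g b).
  by apply: speed_admissible_itv => //; lra.
have P3 : nu' (affine s t @^-1` `]a, b[ `&` `]0%R, 1%R[) <= mms_ell (g x1) (g x2).
  have sub : affine s t @^-1` `]a, b[ `&` `]0%R, 1%R[ `<=`
      [set r | (x1 < affine s t r < x2)%R].
    move=> r [/=]; rewrite !in_itv/= => /andP[ar rb] /andP[r0 r1].
    have sr : (s < affine s t r)%R by rewrite -{1}(affine0 s t) affine_lt.
    have rt : (affine s t r < t)%R by rewrite -{2}(affine1 s t) affine_lt.
    by rewrite gt_max ar gt_min sr orbT/= lt_max lt_min rb rt orbT.
  have m1 : measurable (affine s t @^-1` `]a, b[ `&` `]0%R,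
    1%R[ : set (measurableTypeR R)).
    by apply: measurableI => //; apply: measurable_preimage_affine;
      exact: measurable_itv.
  move: x12; rewrite le_eqVlt => /orP[/eqP x12|x12].
    suff -> : affine s t @^-1` `]a, b[ `&` `]0%R, 1%R[ = set0.
      by rewrite measure0 x12; exact: mms_le_refl.
    by apply/seteqP; split=> // r /sub /=; rewrite x12 => /andP[? ?]; lra.
  have sx1 : (s <= x1)%R.
    move: x12; rewrite /x1 /x2; have [bs|sb] := leP b s.
      by rewrite (min_l (le_trans bs (ltW slt))) ltxx.
    by rewrite le_max lexx orbT.
  have x2t : (x2 <= t)%R.
    move: x12; rewrite /x1 /x2; have [ta|at_] := leP t a.
      have ba : (t <= b)%R by lra.
      by rewrite (min_r ba) (max_l ta); have := ax1; rewrite /x1; lra.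
    by rewrite ge_max (ltW at_) ge_min lexx orbT.
  have := gnu'.2 (inv_affine s t x1) (inv_affine s t x2).
  have iK x : (s <= x <= t)%R -> (0 <= inv_affine s t x <= 1)%R.
    move=> /andP[sx xt]; rewrite inv_affineE// divr_ge0 ?subr_ge0 ?(ltW slt)//.
    by rewrite ler_pdivrMr ?subr_gt0// mul1r lerB.
  have I1 : (0 <= inv_affine s t x1 <= 1)%R by apply: iK; apply/andP; split; lra.
  have I2 : (0 <= inv_affine s t x2 <= 1)%R by apply: iK; apply/andP; split; lra.
  rewrite (lcc_restrictE g st I1) (lcc_restrictE g st I2) !inv_affineK//.
  case/andP : I1 I2 => i10 i11 /andP[i20 i21].
  rewrite -(affine_lt _ _ slt) !inv_affineK// => /(_ i10 x12 i21).
  apply: le_trans; apply: le_measure; rewrite ?inE//.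
  move=> r /sub /=; rewrite in_itv/=.
  by rewrite -(affine_lt (inv_affine s t x1) r slt) -(affine_lt r _ slt)
    !inv_affineK.
have le12 (x y : R) : (0 <= x)%R -> (x <= y)%R -> (y <= 1)%R ->
  mms_le (g x) (g y).
  exact: lcc_causal.
have L1 : mms_le (g a) (g x1) by apply: le12 => //; lra.
have L2 : mms_le (g x1) (g x2) by apply: le12 => //; lra.
have L3 : mms_le (g x2) (g b) by apply: le12 => //; lra.
have L4 : mms_le (g x1) (g b) by apply: le12 => //; lra.
have L : mms_ell (g a) (g x1) + (mms_ell (g x1) (g x2) + mms_ell (g x2) (g b)) <=
    mms_ell (g a) (g b).
  by rewrite (le_trans _ (ell_superadditive L1 L4))// leeD2l// ell_superadditive.
apply: le_trans L; rewrite addeCA; apply: leeD => //.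
apply: le_trans (leeD P1 P2).
apply: le_trans (measureU2 _ _ _) => //.
apply: le_measure; rewrite ?inE//; last 1 first.
- move=> x [/=]; rewrite !in_itv/= => /andP[ax xb] /negP.
  rewrite negb_and -!ltNge => /orP[xs|tx]; [left|right].
    by rewrite ax/= lt_max lt_min xb xs orbT.
  by rewrite xb andbT gt_max ax/= gt_min tx orbT.
- exact: measurableI.
- exact: measurableU.
Qed.

End extension.
Section scaling.
Variable nu : {measure set (measurableTypeR R) -> \bar R}.

(* No constraint bears on the endpoints 0 and 1, so the largest measure is
   infinite there. *)
Definition speed_restrict : {measure set (measurableTypeR R) -> \bar R} :=
  measure_add
    (pushforward_measure (mrestr nu (moo s t))
      (measurable_affine (- s / (t - s)) ((1 - s) / (t - s))))
    (mseries (fun _ : nat => measure_add \d_(0%R : measurableTypeR R)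
      \d_(1%R : measurableTypeR R)) 0).

Lemma speed_restrictE A : speed_restrict A =
  nu (inv_affine s t @^-1` A `&` `]s, t[) +
  \sum_(k <oo) (\d_(0%R : measurableTypeR R) A + \d_(1%R : measurableTypeR R) A).
Proof.
rewrite /speed_restrict [LHS]measure_addE; congr (_ + _).
rewrite /mseries; apply: eq_eseriesr => k _.
exact: measure_addE.
Qed.

Lemma speed_restrict_interior A : ~ A 0%R -> ~ A 1%R ->
  speed_restrict A = nu (inv_affine s t @^-1` A `&` `]s, t[).
Proof.
move=> A0 A1; rewrite speed_restrictE eseries0 ?adde0// => k _ _.
by rewrite !diracE !memNset// adde0.
Qed.

Lemma speed_restrict_endpoint A : A 0%R \/ A 1%R -> speed_restrict A = +oo.
Proof.
move=> A01; rewrite speed_restrictE.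
suff -> : \sum_(k <oo) (\d_(0%R : measurableTypeR R) A +
  \d_(1%R : measurableTypeR R) A) = +oo
    :> \bar R.
  by rewrite addey// gt_eqF// (lt_le_trans _ (measure_ge0 _ _))// ltNy0.
apply/eqP; rewrite -leye_eq.
have <- : \sum_(k <oo) (1 : \bar R) = +oo.
  apply/cvg_lim => //.
  rewrite (_ : (fun n => _) = (fun n => n%:R%:E) :> (nat -> \bar R)); last first.
    apply/funext => n; rewrite (eq_bigr (fun=> 1%:E))//.
    by rewrite sumEFin big_const_nat subn0 iter_addr_0.
  exact/cvgeryP/cvgr_idn.
apply: lee_nneseries => k _ //.
by rewrite !diracE -EFinD lee_fin; case: A01 => /mem_set ->;
  rewrite ?lerDl ?lerDr.
Qed.

Lemma preimage_inv_affine_itv a b :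
  inv_affine s t @^-1` `]a, b[ = `]affine s t a, affine s t b[%classic.
Proof.
by apply/seteqP; split=> x /=; rewrite !in_itv/= -(affine_lt a _ slt)
  -(affine_lt _ b slt) inv_affineK.
Qed.

(** A set containing 0 or 1 has infinite measure, so only sets avoiding both matter for maximality;
    there a competitor is transplanted to [g] by [speed_replace] and compared with [nu]. *)
Lemma speed_restrict_largest : largest_speed_measure g nu ->
  largest_speed_measure (lcc_restrict g st) speed_restrict.
Proof.
move=> [gnu lnu]; have [s0 _ t1] := st; split; [split|].
- rewrite speed_restrict_interior; last 2 first.
    by move=> /=; rewrite in_itv/= lexx ler01.
    by move=> /=; rewrite in_itv/= lexx ler01.
  suff -> : inv_affine s t @^-1` (~` `[0%R, 1%R]) `&` `]s, t[ = set0.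
    by rewrite measure0.
  apply/seteqP; split=> // x [/= xn]; rewrite in_itv/= => /andP[sx xt]; apply: xn.
  rewrite in_itv/= inv_affineE// divr_ge0 ?subr_ge0 ?(ltW sx) ?(ltW slt)//=.
  by rewrite ler_pdivrMr ?subr_gt0// mul1r lerB// ltW.
- move=> a b a0 ab b1; rewrite speed_restrict_interior; last 2 first.
    by rewrite /= in_itv/=; move=> /andP[? ?]; lra.
    by rewrite /= in_itv/=; move=> /andP[? ?]; lra.
  have A0 : (0 <= a <= 1)%R by apply/andP; split; lra.
  have B0 : (0 <= b <= 1)%R by apply/andP; split; lra.
  have /andP[sa _] := affine_itv slt A0; have /andP[_ bt] := affine_itv slt B0.
  rewrite (lcc_restrictE g st A0) (lcc_restrictE g st B0) preimage_inv_affine_itv.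
  apply: (@le_trans _ _ (nu `]affine s t a, affine s t b[%classic)).
    apply: le_measure; rewrite ?inE//.
    exact: measurableI.
  by apply: gnu.2; [lra|rewrite affine_lt|lra].
- move=> nu' nu'P A mA.
  have [A01|/not_orP[A0 A1]] := pselect (A 0%R \/ A 1%R).
    by rewrite (speed_restrict_endpoint A01) leey.
  rewrite speed_restrict_interior//.
  set C := _ `&` _; have mC : measurable C by apply: measurableI => //;
    exact: minv.
  apply: le_trans (lnu _ (speed_replace_admissible gnu nu'P) _ mC).
  rewrite speed_replaceE (@le_trans _ _ (nu' (A `&` `]0%R, 1%R[)))//; last first.
    suff -> : affine s t @^-1` C `&` `]0%R, 1%R[ = A `&` `]0%R, 1%R[.
      by rewrite leeDl.
    apply/seteqP; split=> r [].
      by rewrite /C /= affineK// => -[].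
    move=> Ar r01; split=> //; rewrite /C /= affineK//; split=> //.
    move: r01; rewrite /= !in_itv/= -{1}(affine_lt 0 r slt) -(affine_lt r 1 slt).
    by rewrite affine0 affine1.
  have mO : measurable (~` `[0%R, 1%R]%classic : set (measurableTypeR R)).
    by apply: measurableC; exact: measurable_itv.
  have mAI : measurable (A `&` `]0%R, 1%R[%classic) by exact: measurableI.
  (* As [A] avoids 0 and 1 and [nu'] does not charge the complement of [[0, 1]], only the part of
     [A] in the open interval counts. *)
  apply: (@le_trans _ _ (nu' ((A `&` `]0%R, 1%R[) `|` ~` `[0%R, 1%R]))).
    apply: le_measure; rewrite ?inE//; first exact: measurableU.
    move=> r Ar; have [r01|r01] := pselect (`[0%R, 1%R]%classic r); last by right.
    left; split=> //; move: r01; rewrite /= !in_itv/= !le_eqVlt.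
    move=> /andP[/orP[/eqP r0|->] /orP[/eqP r1|->]]//; exfalso.
    - by apply: A0; rewrite r0.
    - by apply: A0; rewrite r0.
    - by apply: A1; rewrite -r1.
  have nu'O : nu' (~` `[0%R, 1%R]%classic) = 0 := nu'P.1.
  apply: le_trans (measureU2 _ mAI mO) _.
  by rewrite [X in _ + X <= _](_ : _ = 0) ?adde0.
Qed.

(** The infinite masses at the endpoints disappear: the null set removed in [ac_part] can be
    enlarged by two points. Affine maps match null sets on the two sides. *)
Lemma ac_part_speed_restrict (A : set (measurableTypeR R)) : measurable A ->
  A `<=` `[0%R, 1%R]%classic ->
  ac_part speed_restrict A = ac_part nu (inv_affine s t @^-1` A).
Proof.
move=> mA A01'; have mset1 (x : R) :
  measurable ([set x] : set (measurableTypeR R)).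
  exact: measurable_set1.
have null2 (N : set (measurableTypeR R)) (x y : R) : measurable N -> mu N = 0 ->
    measurable (N `|` ([set x] `|` [set y]) : set (measurableTypeR R)) /\
    mu (N `|` ([set x] `|` [set y])) = 0.
  move=> mN N0; have m2 : measurable
    ([set x] `|` [set y] : set (measurableTypeR R)).
    by apply: measurableU; exact: mset1.
  split; first exact: measurableU.
  apply/eqP; rewrite eq_le measure_ge0 andbT.
  apply: le_trans (measureU2 _ mN m2) _;
    rewrite [X in X + _ <= _](_ : _ = 0) ?add0e//.
  apply: le_trans (measureU2 _ (mset1 x) (mset1 y)) _.
  by rewrite /= !lebesgue_measure_set1 adde0.
apply/eqP; rewrite eq_le; apply/andP; split;
  apply: le_ereal_inf_tmp => _ [N [mN N0] <-].
- have m1 : measurable (affine s t @^-1` N : set (measurableTypeR R)).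
    exact: measurable_preimage_affine.
  have n1 : mu (affine s t @^-1` N) = 0 by apply/(null_affine slt mN).
  have [mN1 N10] := null2 _ 0%R 1%R m1 n1.
  apply: le_trans (ereal_inf_lbound _) _;
    first by exists (affine s t @^-1` N `|` ([set 0%R] `|` [set 1%R])).
  rewrite speed_restrict_interior; last 2 first.
    by move=> [_]; apply; right; left.
    by move=> [_]; apply; right; right.
  apply: le_measure; rewrite ?inE//.
  + apply: measurableI => //; apply: minv; exact: measurableD.
  + apply: measurableD => //; exact: minv.
  + move=> x [[/= Ax nx] _]; split=> //= Nx; apply: nx; left => /=.
    by rewrite inv_affineK.
- have m1 : measurable (inv_affine s t @^-1` N : set (measurableTypeR R))
    by exact: minv.
  have n1 : mu (inv_affine s t @^-1` N) = 0.
    apply/(null_affine slt m1).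
    suff -> : affine s t @^-1` (inv_affine s t @^-1` N) = N by [].
    by apply/seteqP; split=> x /=; rewrite affineK.
  have [mN1 N10] := null2 _ s t m1 n1.
  apply: le_trans (ereal_inf_lbound _) _;
    first by exists (inv_affine s t @^-1` N `|` ([set s] `|` [set t])).
  have [A01|/not_orP[A0 A1]] := pselect ((A `\` N) 0%R \/ (A `\` N) 1%R).
    by rewrite (speed_restrict_endpoint A01) leey.
  rewrite speed_restrict_interior//; apply: le_measure; rewrite ?inE//.
  + apply: measurableD => //; exact: minv.
  + apply: measurableI => //; apply: minv; exact: measurableD.
  + move=> x [/= Ax nx]; split; first by split=> // Nx; apply: nx; left.
    have := A01' _ Ax; rewrite /= !in_itv/= inv_affineE// => /andP[].
    rewrite ler_pdivrMr ?ler_pdivlMr ?subr_gt0// mul0r mul1r subr_ge0 lerD2r =>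
      sx xt.
    rewrite !lt_neqAle sx xt !andbT eq_sym; apply/andP; split.
      by apply/eqP => xs; apply: nx; right; left.
    by apply/eqP => xt'; apply: nx; right; right.
Qed.

End scaling.

Lemma is_causal_speed_restrict (v : R -> \bar R) : is_causal_speed g v ->
  is_causal_speed (lcc_restrict g st) (fun r => (t - s)%:E * v (affine s t r)).
Proof.
move=> [mv v0 [nu nuP nuv]]; split.
- apply: emeasurable_funM => //.
  by apply: measurableT_comp => //; exact: measurable_affine.
- by move=> r; rewrite mule_ge0// lee_fin subr_ge0 ltW.
- exists (speed_restrict nu); first exact: speed_restrict_largest.
  move=> A mA A01; rewrite ac_part_speed_restrict//.
  have [s0 _ t1] := st.
  have A01' : inv_affine s t @^-1` A `<=` `[0%R, 1%R]%classic.
    move=> x /A01; rewrite /= !in_itv/= inv_affineE//.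
    rewrite ler_pdivrMr ?ler_pdivlMr ?subr_gt0// => /andP[? ?].
    by apply/andP; split; lra.
  rewrite -nuv//; last exact: minv.
  rewrite -[RHS](integral_affine slt)//; last exact: minv.
  suff -> : affine s t @^-1` (inv_affine s t @^-1` A) = A by [].
  by apply/seteqP; split=> x /=; rewrite affineK.
Qed.

End restriction.

(** One integer records both a bound on [w] and a gap below [v], so the set where [w < v] is a
    countable union of sets on which [w] is bounded and the gap is uniform. *)
Lemma lte_witness (w v : \bar R) : 0 <= w -> w < v ->
  exists N, w <= N%:R%:E /\ w + N.+1%:R^-1%:E <= v.
Proof.
move=> w0 wvx.
have wx : w \is a fin_num by rewrite ge0_fin_numE// (lt_le_trans wvx)// leey.
have [N1 hN1] : exists N1, w <= N1%:R%:E.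
  exists (Num.truncn (fine w)).+1; rewrite -(fineK wx) lee_fin ltW//.
  exact: truncnS_gt.
have [N2 hN2] : exists N2, w + N2.+1%:R^-1%:E <= v.
  move: wvx; rewrite -(fineK wx); case: v => [r| |]//; last by exists 0%N;
    rewrite leey.
  rewrite lte_fin => rw; exists (Num.truncn (r - fine w)^-1).
  rewrite -EFinD lee_fin -lerBrDl ltW// invf_plt ?posrE ?subr_gt0//.
  exact: truncnS_gt.
exists (maxn N1 N2); split.
  by apply: le_trans hN1 _; rewrite lee_fin ler_nat leq_maxl.
apply: le_trans hN2; rewrite leeD2l// lee_fin lef_pV2 ?posrE//.
by rewrite ler_nat ltnS leq_maxr.
Qed.

(** On [A n] the integral of [w] is finite and [v] exceeds [w] by [1 / (n + 1)], which contradicts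
    the comparison of integrals unless [A n] is null. *)
Lemma ae_le_of_integral (D : set (measurableTypeR R)) (v w : R -> \bar R) :
  measurable D -> mu D < +oo ->
  measurable_fun setT v -> (forall x, 0 <= v x) ->
  measurable_fun setT w -> (forall x, 0 <= w x) ->
  (forall A, measurable A -> A `<=` D ->
    \int[mu]_(x in A) v x <= \int[mu]_(x in A) w x) ->
  {ae mu, forall x, D x -> v x <= w x}.
Proof.
move=> mD Dfin mv v0 mw w0 vw.
pose A n := D `&` [set x | w x <= n%:R%:E] `&`
  [set x | w x + n.+1%:R^-1%:E <= v x].
have mA n : measurable (A n : set (measurableTypeR R)).
  apply: measurableI; last first.
    rewrite -[X in measurable X]setTI; apply: measurable_lee => //.
    exact: emeasurable_funD.
  apply: measurableI => //.
  by rewrite -[X in measurable X]setTI; apply: measurable_lee.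
have A0 n : mu (A n) = 0.
  have An : mu (A n) < +oo.
    apply: le_lt_trans Dfin; apply: le_measure; rewrite ?inE//.
    by move=> x [[]].
  have AD : A n `<=` D by move=> x [[]].
  have wfin : \int[mu]_(x in A n) w x < +oo.
    apply: (@le_lt_trans _ _ (\int[mu]_(x in A n) n%:R%:E)).
      apply: ge0_le_integral => //; first exact: measurable_funTS.
      by move=> x [[]].
    by rewrite integral_cst// lte_mul_pinfty.
  have := vw _ (mA n) AD; apply: contraPP => /eqP An0.
  have Apos : 0 < mu (A n) by rewrite lt0e An0 measure_ge0.
  apply/negP; rewrite -ltNge.
  apply: (@lt_le_trans _ _ (\int[mu]_(x in A n) (w x + n.+1%:R^-1%:E))).
    rewrite ge0_integralD//; [|exact: measurable_funTS].
    rewrite integral_cst// lteDl ?mule_gt0 ?lte_fin ?invr_gt0//.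
    by rewrite ge0_fin_numE// integral_ge0.
  apply: ge0_le_integral => //.
  - by move=> x _; rewrite adde_ge0.
  - by apply: emeasurable_funD => //; exact: measurable_funTS.
  - exact: measurable_funTS.
  - by move=> x [].
apply: (@negligibleS _ _ _ mu (\bigcup_n A n)); last first.
  by apply: negligible_bigcup => n; apply/(negligibleP mu (mA n)); exact: A0.
move=> x /= /not_implyP[Dx /negP]; rewrite -ltNge => wvx.
by have [N [wN Nv]] := lte_witness (w0 x) wvx; exists N.
Qed.

(** Two largest measures dominate each other, so [v] and [w] are densities of the same absolutely
    continuous part. *)
Lemma is_causal_speed_ae_unique g (v w : R -> \bar R) :
  is_causal_speed g v -> is_causal_speed g w ->
  {ae mu, forall x, (0 <= x <= 1)%R -> v x = w x}.
Proof.
move=> [mv v0 [nu [gnu lnu] nuv]] [mw w0 [nu' [gnu' lnu'] nuw]].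
have vw (A : set (measurableTypeR R)) : measurable A ->
  A `<=` `[0%R, 1%R]%classic ->
    \int[mu]_(x in A) v x = \int[mu]_(x in A) w x.
  move=> mA A01; rewrite nuv// nuw//; rewrite /ac_part.
  congr ereal_inf; apply/seteqP; split=> _ [N [mN N0] <-]; exists N => //.
    by apply/eqP; rewrite eq_le lnu// ?lnu'//; exact: measurableD.
  by apply/eqP; rewrite eq_le lnu// ?lnu'//; exact: measurableD.
have fin : mu `[0%R, 1%R]%classic < +oo.
  by rewrite lebesgue_measure_itv/= lte_fin ltr01 -EFinB ltry.
have m01 : measurable (`[0%R, 1%R]%classic : set (measurableTypeR R)).
  exact: measurable_itv.
have vw1 : {ae mu, forall x, `[0%R, 1%R]%classic x -> v x <= w x}.
  by apply: ae_le_of_integral => // A mA A01; rewrite vw.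
have vw2 : {ae mu, forall x, `[0%R, 1%R]%classic x -> w x <= v x}.
  by apply: ae_le_of_integral => // A mA A01; rewrite vw.
have FF : Filter (nbhs (almost_everywhere mu)).
  exact: ae_filter_ringOfSetsType.
apply: filterS2 vw1 vw2 => x h1 h2 x01.
by apply/eqP; rewrite eq_le h1 ?h2//= in_itv.
Qed.

(** For a curve without causal speed the default value 0 makes the speed integral vanish, and the
    subslope inequality becomes trivial on it. *)
Lemma causal_speedP g :
  is_causal_speed g (causal_speed g) \/ causal_speed g = cst 0.
Proof. by rewrite /causal_speed; case: xgetP => [v ->|]; [left|right]. Qed.

Lemma measurable_causal_speed g : measurable_fun setT (causal_speed g).
Proof. by have [[]|->] := causal_speedP g. Qed.

Lemma causal_speed_ge0 g t : 0 <= causal_speed g t.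
Proof. by have [[_ +]|->] := causal_speedP g. Qed.

(** [causal_speed] is a choice made curve by curve. On the restriction it agrees with the rescaled
    speed of [g] only almost everywhere, which suffices under the integral; the factor [t - s] is
    absorbed by the substitution. *)
Lemma integral_causal_speed_restrict g (G : M -> \bar R) (s t : R)
    (st : [/\ (0 <= s)%R, (s < t)%R & (t <= 1)%R]) :
  measurable_fun setT (G : borel M -> \bar R) -> (forall x, 0 <= G x) ->
  is_causal_speed g (causal_speed g) ->
  \int[mu]_(r in `[0%R, 1%R])
    (G (lcc_restrict g st r) * causal_speed (lcc_restrict g st) r) =
  \int[mu]_(r in `[s, t]) (G (g r) * causal_speed g r).
Proof.
move=> mG G0 gv; have [s0 slt t1] := st.
have rv := is_causal_speed_restrict st gv.
have rw : is_causal_speed (lcc_restrict g st) (causal_speed (lcc_restrict g st)).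
  have [//|] := causal_speedP (lcc_restrict g st).
  by rewrite /causal_speed; case: xgetP => // /(_ _ rv).
have mGg : measurable_fun setT (fun r : R => G (g r) * causal_speed g r).
  apply: emeasurable_funM; last exact: measurable_causal_speed.
  exact: measurable_comp_lcc.
have Gg0 r : 0 <= G (g r) * causal_speed g r by rewrite mule_ge0//
  causal_speed_ge0.
rewrite -[RHS](integral_affine slt)//.
rewrite preimage_affine_itv//.
apply: ge0_ae_eq_integral => //.
- apply: measurable_funTS; apply: emeasurable_funM;
    last exact: measurable_causal_speed.
  exact: measurable_comp_lcc.
- apply: measurable_funTS; apply: emeasurable_funM => //.
  by apply: (measurableT_comp mGg); exact: measurable_affine.
- by move=> r _; rewrite mule_ge0// causal_speed_ge0.
- by move=> r _; rewrite mule_ge0// lee_fin subr_ge0 ltW.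
have FF : Filter (nbhs (almost_everywhere mu)).
  exact: ae_filter_ringOfSetsType.
apply: filterS (is_causal_speed_ae_unique rw rv) => r rE r01'.
have r01 : (0 <= r <= 1)%R by move: r01'; rewrite /= in_itv.
by rewrite rE// (lcc_restrictE g st r01) muleCA.
Qed.

End speed_of_restrictions.

(** * Borel structure of the space of curves *)

Section borel_structure_of_curves.
Context {R : realType} (M : mm_spacetime R) (d : M -> M -> R).
Hypothesis hd : bounded_distance_inducing d.
Implicit Types g h : lcc M.
Notation mu := (@lebesgue_measure R).

Lemma dist_ge0 x y : 0 <= d x y. Proof. by case: hd => -[]. Qed.
Lemma dist_refl x : d x x = 0. Proof. by case: hd => -[_ + _ _] _ _ =>
    /(_ x x)[_ ->]. Qed.
Lemma dist_sym x y : d x y = d y x. Proof. by case: hd => -[]. Qed.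
Lemma dist_triangle x y z : d x z <= d x y + d y z. Proof. by case: hd =>
    -[]. Qed.

Lemma dist_lipschitz x y z : `|d x y - d x z| <= d y z.
Proof.
rewrite ler_norml; have := dist_triangle x y z; have := dist_triangle x z y.
by rewrite (dist_sym z y) => ? ?; apply/andP; split; lra.
Qed.

Lemma nbhs_dist (x : M) (A : set M) :
  nbhs x A <-> exists2 e : R, 0 < e & [set y | d x y < e] `<=` A.
Proof. by case: hd. Qed.

Lemma dense_sequence : exists x : nat -> M, forall y (e : R), 0 < e ->
  exists n, d y (x n) < e.
Proof.
have [[S cS dS] _] := mms_polish M.
have dP y (e : R) : 0 < e -> exists2 z, S z & d y z < e.
  move=> e0.
  have [||z [zO Sz]] := dS (interior [set z | d y z < e]).
  - exists y; apply/nbhs_dist; exists e => //.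
  - exact: open_interior.
  - by exists z => //; exact: interior_subset zO.
have [z0 Sz0 _] := dP point 1 ltr01.
have /pfcard_geP[S0|[f]] := cS; first by move: Sz0; rewrite S0.
exists f => y e e0; have [z Sz yz] := dP y e e0.
by have [n _ fn] := @surj _ _ _ _ f _ Sz; exists n; rewrite fn.
Qed.

(** By separability an open set is a countable union of balls with radii [1 / (k + 1)] around the
    points of a dense sequence. *)
Lemma measurable_fun_dist dX (X : measurableType dX) (f : X -> M) :
  (forall x, measurable_fun setT (fun w => d x (f w))) ->
  measurable_fun setT (f : X -> borel M).
Proof.
move=> mf; have [x xP] := dense_sequence.
apply: (@measurability _ _ X (borel M) _ _ (@open M)) => //.
move=> _ [U oU <-]; rewrite setTI.
pose P n k := forall y, d (x n) y < k.+1%:R^-1 -> U y.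
pose F n k := if `[< P n k >] then
  [set w | d (x n) (f w) < k.+1%:R^-1] else set0.
rewrite (_ : f @^-1` U = \bigcup_n \bigcup_k F n k).
  apply: bigcupT_measurable => n; apply: bigcupT_measurable => k.
  rewrite /F; case: ifP => // _.
  rewrite -[X in measurable X]setTI.
  by apply: measurable_fun_ltr => //; exact: mf.
apply/seteqP; split=> [w Uw|w [n _ [k _]]].
  have /nbhs_dist[e e0 eU] : nbhs (f w) U by exact: open_nbhs_nbhs.
  have [k ke] : exists k, k.+1%:R^-1 < e / 2.
    by exists (Num.truncn (e / 2)^-1);
      rewrite invf_plt ?posrE ?divr_gt0// truncnS_gt.
  have [n xn] := xP (f w) k.+1%:R^-1 ltac:(by rewrite invr_gt0).
  exists n => //; exists k => //; rewrite /F asboolT /=;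
    first by rewrite dist_sym.
  move=> y xy; apply: eU => /=; have := dist_triangle (f w) (x n) y.
  by move: (k.+1%:R^-1 : R) ke xn xy => c; lra.
by rewrite /F; case: ifP => // /asboolP Pn /Pn.
Qed.

Definition left_continuous (f : R -> M) :=
  forall t (U : set M), nbhs (f t) U ->
    exists2 e : R, 0 < e & forall u, t - e < u <= t -> U (f u).

(** A strict lower bound on the distance at time [t] persists on an interval to the left of [t], so
    [left_itv_measurable] applies to superlevel sets. *)
Lemma measurable_dist_curves (f g : R -> M) :
  left_continuous f -> left_continuous g ->
  measurable_fun setT (fun t : R => d (f t) (g t)).
Proof.
move=> lf lg; apply: (measurability _ (RGenOInfty.measurableE R)) => //.
move=> _ [_ [q ->] <-]; rewrite setTI.
apply: left_itv_measurable => t; rewrite /= in_itv/= andbT => qt.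
pose c := (d (f t) (g t) - q) / 2.
have c0 : 0 < c by rewrite divr_gt0// subr_gt0.
have [e1 e10 e1P] := lf t [set y | d (f t) y < c]
  ltac:(by apply/nbhs_dist; exists c).
have [e2 e20 e2P] := lg t [set y | d (g t) y < c]
  ltac:(by apply/nbhs_dist; exists c).
exists (Num.min e1 e2); first by rewrite lt_min e10.
move=> u; rewrite ltrBlDr -ltrBlDl lt_min => /andP[/andP[tu1 tu2] ut].
rewrite in_itv/= andbT.
have /= h1 : d (f t) (f u) < c by apply: e1P; rewrite ut andbT; lra.
have /= h2 : d (g t) (g u) < c by apply: e2P; rewrite ut andbT; lra.
have := dist_triangle (f t) (f u) (g t); have := dist_triangle (f u) (g u) (g t).
rewrite (dist_sym (g u)); rewrite /c in h1 h2; lra.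
Qed.

Lemma integrable_dist_curves (f g : R -> M) (A : set (measurableTypeR R)) :
  left_continuous f -> left_continuous g -> measurable A ->
    A `<=` `[0, 1]%classic ->
  mu.-integrable A (EFin \o (fun t => d (f t) (g t))).
Proof.
move=> lf lg mA A01; apply: measurable_bounded_integrable => //.
- apply: (@le_lt_trans _ _ (mu `[0, 1]%classic)).
    by apply: le_measure; rewrite ?inE.
  by rewrite lebesgue_measure_itv/= lte_fin ltr01 -EFinB ltry.
- by apply: measurable_funTS; exact: measurable_dist_curves.
- have [_ _ [K dK]] := hd; exists K; split=> [|c Kc x _]; first exact: num_real.
  by rewrite /= ger0_norm ?dist_ge0// (le_trans (dK _ _))// ltW.
Qed.

Lemma lcc_left_cts g : left_continuous g.
Proof. by move=> t U; exact: lcc_left_nbhs. Qed.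

Lemma cst_left_cts (x : M) : left_continuous (cst x).
Proof. by move=> t U Ux; exists 1 => // u _; exact: nbhs_singleton. Qed.

Lemma lcc_dist_triangle g1 g2 g3 :
  lcc_dist d g1 g3 <= lcc_dist d g1 g2 + lcc_dist d g2 g3.
Proof.
rewrite /lcc_dist addrACA lerD ?dist_triangle// -RintegralD//.
- apply: le_Rintegral => //.
  + by apply: integrable_dist_curves => //; exact: lcc_left_cts.
  + apply: (@eq_integrable _ _ _ mu `[0, 1] _
      ((EFin \o (fun t => d (g1 t) (g2 t))) \+
        (EFin \o (fun t => d (g2 t) (g3 t))))%E) => //.
    by apply: integrableD => //; apply: integrable_dist_curves => //;
      exact: lcc_left_cts.
  + by move=> x _; exact: dist_triangle.
- by apply: integrable_dist_curves => //; exact: lcc_left_cts.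
- by apply: integrable_dist_curves => //; exact: lcc_left_cts.
Qed.

Lemma Rintegral_dist_le (A : set (measurableTypeR R)) g h :
  measurable A -> A `<=` `[0, 1]%classic ->
  \int[mu]_(t in A) d (g t) (h t) <= lcc_dist d g h.
Proof.
move=> mA A01; rewrite /lcc_dist
  (le_trans (y := \int[mu]_(t in `[0, 1]) d (g t) (h t)))//.
  rewrite /Rintegral fine_le//.
  - by apply: integrable_fin_num => //; apply: integrable_dist_curves => //;
      exact: lcc_left_cts.
  - by apply: integrable_fin_num => //; apply: integrable_dist_curves => //;
      exact: lcc_left_cts.
  - apply: ge0_subset_integral => //.
    + apply/measurable_EFinP; apply: measurable_funTS.
      by apply: measurable_dist_curves; exact: lcc_left_cts.
    + by move=> x _; rewrite lee_fin dist_ge0.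
by rewrite lerDr dist_ge0.
Qed.

(** Superlevel sets of [L] belong to [lcc_open], which generates the sigma-algebra. The proof uses
    the constant [|K| + 1], which is positive for every [K]. *)
Lemma lipschitz_measurable (L : lcc M -> R) (K : R) :
  (forall g h, `|L g - L h| <= K * lcc_dist d g h) ->
  measurable_fun setT (L : borel_lcc d -> R).
Proof.
move=> LK; apply: (measurability _ (RGenOInfty.measurableE R)) => //.
move=> _ [_ [q ->] <-]; rewrite setTI; apply: sub_sigma_algebra.
move=> g /=; rewrite in_itv/= andbT => qg.
have K1 : 0 < `|K| + 1 by have := normr_ge0 K; lra.
exists ((L g - q) / (`|K| + 1)); first by rewrite divr_gt0// subr_gt0.
move=> h /=; rewrite ltr_pdivlMr// in_itv/= andbT => gh.
have := LK g h; have := ler_norm (L g - L h).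
have D0 : 0 <= lcc_dist d g h.
  by rewrite /lcc_dist addr_ge0 ?dist_ge0// Rintegral_ge0// => x _;
    exact: dist_ge0.
have := ler_wpM2r D0 (ler_norm K); lra.
Qed.

End borel_structure_of_curves.

(** * Evaluation and restriction are Borel maps *)

Section measurable_maps_of_curves.
Context {R : realType} (M : mm_spacetime R) (d : M -> M -> R).
Hypothesis hd : bounded_distance_inducing d.
Implicit Types g h : lcc M.
Notation mu := (@lebesgue_measure R).

Lemma Rintegral_dist_triangle (A : set (measurableTypeR R)) (c1 c2 c3 : R -> M) :
  measurable A -> A `<=` `[0, 1]%classic ->
  left_continuous c1 -> left_continuous c2 -> left_continuous c3 ->
  \int[mu]_(t in A) d (c1 t) (c3 t) <=
  \int[mu]_(t in A) d (c1 t) (c2 t) + \int[mu]_(t in A) d (c2 t) (c3 t).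
Proof.
move=> mA A01 l1 l2 l3; rewrite -RintegralD//;
  [|exact: (integrable_dist_curves hd)..].
apply: le_Rintegral => //.
- exact: (integrable_dist_curves hd).
- apply: (@eq_integrable _ _ _ mu A _ ((EFin \o (fun t => d (c1 t) (c2 t))) \+
      (EFin \o (fun t => d (c2 t) (c3 t))))%E) => //.
  by apply: integrableD => //; exact: (integrable_dist_curves hd).
- by move=> x _; exact: (dist_triangle hd).
Qed.

Lemma measurable_Rintegral_dist (A : set (measurableTypeR R)) (c : R -> M) :
  measurable A -> A `<=` `[0, 1]%classic -> left_continuous c ->
  measurable_fun setT (fun g : borel_lcc d =>
    \int[mu]_(t in A) d (c t) ((g : lcc M) t)).
Proof.
move=> mA A01 lc; apply: (lipschitz_measurable hd (K := 1)) => g h.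
have H g1 g2 : \int[mu]_(t in A) d (c t) (g1 t) - \int[mu]_(t in A) d (c t)
  (g2 t) <=
    lcc_dist d g2 g1.
  rewrite lerBlDl (le_trans
    (Rintegral_dist_triangle mA A01 lc (@lcc_left_cts _ _ g2)
    (@lcc_left_cts _ _ g1)))//.
  by rewrite lerD2l; exact: Rintegral_dist_le.
have lsym : lcc_dist d g h = lcc_dist d h g.
  rewrite /lcc_dist (dist_sym hd); congr (_ + _).
  by apply: eq_Rintegral => x _; rewrite (dist_sym hd).
rewrite mul1r ler_norml {2}lsym H andbT lerNl opprB; exact: H.
Qed.

(* Evaluation at s is not continuous on LCC; it is the limit of averages over
   [s - h, s], which are Lipschitz. *)
Lemma measurable_eval (s : R) :
  measurable_fun setT (fun g : borel_lcc d => (g : lcc M) s : borel M).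
Proof.
apply: (measurable_fun_dist hd) => x.
(* The distance on curves contains the term [d (g 0) (h 0)], so evaluation at the initial point is
   Lipschitz. *)
have [s0|s0] := leP s 0.
  apply: (lipschitz_measurable hd (K := 1)) => g h.
  rewrite (lcc_constant_left g s0) (lcc_constant_left h s0) mul1r.
  rewrite (le_trans (dist_lipschitz hd _ _ _))// /lcc_dist lerDl.
  by apply: Rintegral_ge0 => t _; exact: (dist_ge0 hd).
wlog s1 : s s0 / s <= 1 => [H|].
  have [/H|s1] := leP s 1; first exact.
  rewrite (_ : (fun g : borel_lcc d => d x ((g : lcc M) s)) =
               (fun g : borel_lcc d => d x ((g : lcc M) 1))); first exact: H.
  by apply/funext => g; rewrite (lcc_constant_right g (ltW s1)).
pose a n := s / n.+2%:R.
have a0 n : 0 < a n by rewrite divr_gt0.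
have as_ n : a n <= s by rewrite /a ler_pdivrMr// ler_peMr ?ler1n// ltW.
have sub01 n : `[s - a n, s]%classic `<=` `[0, 1]%classic.
  move=> r /=; rewrite !in_itv/= => /andP[sr rs].
  by have := as_ n => ?; apply/andP; split; lra.
pose F n (g : borel_lcc d) :=
  (a n)^-1 * \int[mu]_(r in `[s - a n, s]) d x ((g : lcc M) r).
apply: (@measurable_fun_cvg _ _ _ setT F).
  move=> n; apply: measurable_funM => //.
  apply: (measurable_Rintegral_dist (c := cst x)) => //.
  exact: cst_left_cts.
move=> g _; apply/cvgrPdist_le => e e0.
have [e1 e10 e1P] := lcc_left_nbhs (g := (g : lcc M)) (t := s)
  (U := [set y | d ((g : lcc M) s) y < e])
  ltac:(by apply/(nbhs_dist hd); exists e).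
near=> n.
have ae : a n < e1.
  rewrite /a ltr_pdivrMr// -ltr_pdivrMl// mulrC.
  apply: (@lt_trans _ _ n%:R); last by rewrite ltr_nat.
  by near: n; exact: nbhs_infty_gtr.
have int : mu.-integrable `[s - a n, s] (EFin \o (fun r => d x ((g : lcc M) r))).
  by apply: (integrable_dist_curves hd (f := cst x)) => //;
    [exact: cst_left_cts|exact: lcc_left_cts].
have intc (c : R) : mu.-integrable `[s - a n, s] (EFin \o cst c).
  apply: measurable_bounded_integrable; first exact: measurable_itv.
  - by rewrite /= lebesgue_measure_itv/=; case: ifP => // _; rewrite -EFinB ltry.
  - exact: measurable_cst.
  by exists `|c|; split=> [|M' cM x0 _]; [exact: num_real|exact: ltW].
have intcE (c : R) : \int[mu]_(r in `[s - a n, s]) (cst c) r = c * a n.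
  rewrite Rintegral_cst//= lebesgue_measure_itv/= lte_fin ltrBlDr ltrDl a0/=.
  by rewrite opprB addrCA subrr addr0.
have b r : `[s - a n, s]%classic r ->
  `|d x ((g : lcc M) r) - d x ((g : lcc M) s)| <= e.
  rewrite /= in_itv/= => /andP[sr rs].
  rewrite (le_trans (dist_lipschitz hd _ _ _))// (dist_sym hd) ltW//.
  by apply: e1P; rewrite rs andbT; lra.
have up : \int[mu]_(r in `[s - a n, s]) d x ((g : lcc M) r) <=
    (d x ((g : lcc M) s) + e) * a n.
  rewrite -intcE; apply: le_Rintegral => // r /b;
    rewrite ler_norml /= => /andP[? ?]; lra.
have lo : (d x ((g : lcc M) s) - e) * a n <=
    \int[mu]_(r in `[s - a n, s]) d x ((g : lcc M) r).
  rewrite -intcE; apply: le_Rintegral => // r /b;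
    rewrite ler_norml /= => /andP[? ?]; lra.
rewrite /F ler_distlC; apply/andP; split.
  by rewrite mulrC ler_pdivlMr.
by rewrite mulrC ler_pdivrMr.
Unshelve. all: by end_near. Qed.

Section restriction.
Variables (s t : R) (st : [/\ 0 <= s, s < t & t <= 1]).

(** The restricted curves start at [g s] and [h s], whose distance [lcc_dist] does not control; it
    therefore stands as a separate term. *)
Lemma lcc_dist_restrict g h :
    lcc_dist d (lcc_restrict g st) (lcc_restrict h st) <=
  d (g s) (h s) + (t - s)^-1 * lcc_dist d g h.
Proof.
have [s0 slt t1] := st; have ts0 : 0 < t - s by rewrite subr_gt0.
have z01 : 0 <= (0 : R) <= 1 by rewrite lexx ler01.
rewrite {1}/lcc_dist (lcc_restrictE g st z01) (lcc_restrictE h st z01) affine0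
  lerD2l.
rewrite ler_pdivlMl//.
have m01 : measurable (`[s, t]%classic : set (measurableTypeR R))
  by exact: measurable_itv.
have sub01 : `[s, t]%classic `<=` `[0, 1]%classic.
  by move=> r; rewrite /= !in_itv/= => /andP[? ?]; apply/andP; split; lra.
rewrite (le_trans _ (Rintegral_dist_le hd g h m01 sub01))//.
have mdg : measurable_fun setT (fun r : R => (d (g r) (h r))%:E).
  by apply/measurable_EFinP; apply: (measurable_dist_curves hd);
    exact: lcc_left_cts.
have IA : (\int[mu]_(r in `[s, t]) (d (g r) (h r))%:E =
    (t - s)%:E * \int[mu]_(x in `[0%R, 1%R])
      (d (g (affine s t x)) (h (affine s t x)))%:E)%E.
  rewrite -(integral_affine slt)//; last by move=> r;
    rewrite lee_fin (dist_ge0 hd).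
  rewrite preimage_affine_itv//.
  rewrite ge0_integralZl//.
  - by apply: measurable_funTS; apply: (measurableT_comp mdg);
      exact: measurable_affine.
  - by move=> r _; rewrite lee_fin (dist_ge0 hd).
  - by rewrite lee_fin ltW.
rewrite /Rintegral IA.
have r01 : measurable (`[0, 1]%classic : set (measurableTypeR R))
  by exact: measurable_itv.
have E : (\int[mu]_(x in `[0%R, 1%R])
  (d (g (affine s t x)) (h (affine s t x)))%:E =
    \int[mu]_(x in `[0%R, 1%R])
      (d (lcc_restrict g st x) (lcc_restrict h st x))%:E)%E.
  apply: eq_integral => r; rewrite inE => r01'.
  have r01'' : 0 <= r <= 1 by move: r01'; rewrite /= in_itv.
  by rewrite !lcc_restrictE.
rewrite E fineM// integrable_fin_num//.
by apply: (integrable_dist_curves hd) => //; exact: lcc_left_cts.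
Qed.

(** By [lcc_dist_restrict], the restriction depends continuously on the pair of [g] and [g s], and
    the second component is Borel in [g] by [measurable_eval]. *)
Lemma measurable_lcc_restrict :
  measurable_fun setT (fun g : borel_lcc d => lcc_restrict g st : borel_lcc d).
Proof.
have [s0 slt t1] := st; have ts0 : 0 < t - s by rewrite subr_gt0.
apply: (@measurability _ _ (borel_lcc d) (borel_lcc d) _ _ (lcc_open d)) => //.
move=> _ [U oU <-]; rewrite setTI.
(* The preimage of U is the countable union, over balls B of M, of the curves
   of an open set V with g s in B, so LCC need not be separable. *)
have [x xP] := dense_sequence hd.
pose q k : R := k.+1%:R^-1.
pose V n k : set (lcc M) := [set g | exists2 e : R, 0 < e & forall h,
  lcc_dist d g h < e -> d (x n) (h s) < q k -> U (lcc_restrict h st)].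
have mV n k : measurable (V n k : set (borel_lcc d)).
  apply: sub_sigma_algebra => g [e e0 eP]; exists (e / 2);
    first by rewrite divr_gt0.
  move=> g' /= gg'; exists (e / 2); first by rewrite divr_gt0.
  move=> h g'h; apply: eP.
  by have := lcc_dist_triangle hd g g' h; lra.
rewrite (_ : _ @^-1` U = \bigcup_n \bigcup_k
    (V n k `&` [set g | d (x n) ((g : lcc M) s) < q k])).
  apply: bigcupT_measurable => n; apply: bigcupT_measurable => k.
  apply: measurableI => //.
  rewrite -[X in measurable X]setTI; apply: measurable_fun_ltr => //.
  have mdx : measurable_fun setT (d (x n) : borel M -> R).
    apply: (measurability _ (RGenOInfty.measurableE R)) => //.
    move=> _ [_ [c ->] <-]; rewrite setTI; apply: sub_sigma_algebra.
    rewrite openE => y /=; rewrite in_itv/= andbT => cy.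
    apply/(nbhs_dist hd); exists (d (x n) y - c); first by rewrite subr_gt0.
    move=> z /= yz; rewrite in_itv/= andbT.
    by have := dist_triangle hd (x n) z y; rewrite (dist_sym hd z); lra.
  exact: (measurableT_comp mdx (measurable_eval s)).
apply/seteqP; split=> [g Ug|g [n _ [k _ [[e e0 eP] gs]]]]; last first.
  apply: eP => //; rewrite /lcc_dist (dist_refl hd) add0r.
  rewrite (_ : (fun t => _) = cst 0) ?Rintegral_cst ?mul0r//.
  by apply/funext => r; exact: (dist_refl hd).
have [e e0 eP] := oU _ Ug.
(* Passing through [x n] gives [d (g s) (h s) < 2 * q k < e / 2]; the other half of [e] is left for
   the integral term. *)
have [k ke] : exists k, q k < e / 4.
  by exists (Num.truncn (e / 4)^-1);
    rewrite invf_plt ?posrE ?divr_gt0// truncnS_gt.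
have [n xn] := xP (g s) (q k) ltac:(by rewrite invr_gt0).
exists n => //; exists k => //; split; last by rewrite /= (dist_sym hd).
exists ((t - s) * (e / 2)); first by rewrite mulr_gt0// divr_gt0.
move=> h gh xh; apply: eP => /=; apply: le_lt_trans (lcc_dist_restrict g h) _.
have : (t - s)^-1 * lcc_dist d g h < e / 2 by rewrite ltr_pdivrMl.
have := dist_triangle hd (g s) (x n) (h s).
move: (q k) ke xn xh => c; lra.
Qed.

End restriction.
End measurable_maps_of_curves.

(** * Subslopes along almost every curve *)

Section upper_integrals.
Local Open Scope ereal_scope.
Context {R : realType}.

(** The integral of a nonnegative function is a supremum over simple functions below it, hence
    monotone even without measurability. It is applied to increments of causal functions, which are
    measurable only up to null sets. *)
Lemma ge0_le_lower_integral d (T : measurableType d)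
    (m : {measure set T -> \bar R}) (f g : T -> \bar R) :
  (forall x, 0 <= f x) -> (forall x, f x <= g x) ->
  \int[m]_x f x <= \int[m]_x g x.
Proof.
move=> f0 fg; have g0 x : 0 <= g x by exact: le_trans (fg x).
rewrite !ge0_integralTE//; apply: ereal_sup_le => _ [h hf <-].
by exists h => // x; exact: le_trans (hf x) (fg x).
Qed.

(** [Y] is the intersection of a minimizing sequence of measurable supersets. Its intersection with
    [Z] is again a measurable superset of [X], so it cannot have smaller probability. *)
Lemma measurable_hull d (T : measurableType d) (P : probability T R) (X : set T) :
  exists Y, [/\ measurable Y, X `<=` Y &
    forall Z, measurable Z -> X `<=` Z -> P (Y `\` Z) = 0].
Proof.
pose S := [set P Y | Y in [set Y | measurable Y /\ X `<=` Y]].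
have S0 : 0 <= ereal_inf S by apply: le_ereal_inf_tmp => _ [Y _ <-].
have S1 : ereal_inf S <= 1.
  by apply: ereal_inf_lbound; exists setT => //; exact: probability_setT.
have Sfin : ereal_inf S \is a fin_num.
  by rewrite ge0_fin_numE// (le_lt_trans S1)// ltry.
have cY n : exists Y, [/\ measurable Y,
  X `<=` Y & P Y < ereal_inf S + n.+1%:R^-1%:E].
  have := @lb_ereal_inf_adherent _ S n.+1%:R^-1 ltac:(by rewrite invr_gt0) Sfin.
  by move=> [_ [Y [mY XY] <-] YS]; exists Y.
have [Y YP] := choice cY.
have mY n : measurable (Y n) by case: (YP n).
exists (\bigcap_n Y n); split.
- exact: bigcapT_measurable.
- by move=> x Xx n _; have [_ + _] := YP n; apply.
move=> Z mZ XZ.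
have mI : measurable (\bigcap_n Y n) by exact: bigcapT_measurable.
have le1 : P (\bigcap_n Y n) <= ereal_inf S.
  apply/lee_addgt0Pr => e e0.
  have [n ne] : exists n, (n.+1%:R^-1 < e)%R.
    by exists (Num.truncn e^-1); rewrite invf_plt ?posrE// truncnS_gt.
  apply: (@le_trans _ _ (P (Y n))).
    by apply: le_measure; rewrite ?inE// => x; apply.
  by have [_ _ /ltW/le_trans] := YP n; apply; rewrite leeD2l// lee_fin ltW.
have le2 : ereal_inf S <= P (\bigcap_n Y n `&` Z).
  apply: ereal_inf_lbound; exists (\bigcap_n Y n `&` Z) => //; split.
    exact: measurableI.
  by move=> x Xx; split; [move=> n _; have [_ + _] := YP n; apply|exact: XZ].
apply/eqP; rewrite eq_le measure_ge0 andbT measureD//; last first.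
  by rewrite (le_lt_trans (probability_le1 P mI))// ltry.
by rewrite leeBlDr ?add0e ?(le_trans le1 le2)// fin_num_measure//;
  exact: measurableI.
Qed.

Section conditioning.
Context d d' (T : measurableType d) (T' : measurableType d')
  (P : probability T R).
Variables (A : set T) (mA : measurable A) (PA : 0 < P A).
Variables (phi : T -> T') (mphi : measurable_fun setT phi).

Let PAfin : P A \is a fin_num. Proof. exact: fin_num_measure. Qed.
Let PA0 : (0 < fine (P A))%R.
Proof. by rewrite -lte_fin fineK. Qed.
Let c0 : (0 <= (fine (P A))^-1)%R. Proof. by rewrite invr_ge0 ltW. Qed.

(** The law of [phi] under [P] conditioned on [A]. With [phi] the restriction to [[s, t]], this is
    the plan on which subslopes are tested. *)
Definition conditional_image : set T' -> \bar R :=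
  mscale (NngNum c0) (pushforward_measure (mrestr P mA) mphi).

HB.instance Definition _ := Measure.on conditional_image.

Lemma conditional_imageE B :
  conditional_image B = (fine (P A))^-1%:E * P (phi @^-1` B `&` A).
Proof. by []. Qed.

Let conditional_imageT : conditional_image setT = 1.
Proof.
rewrite conditional_imageE preimage_setT setTI -[X in _ * X]fineK//.
by rewrite -EFinM mulVf// gt_eqF.
Qed.

HB.instance Definition _ :=
  Measure_isProbability.Build _ _ _ conditional_image conditional_imageT.

End conditioning.

(* F need not be measurable; the test sets A are measurable hulls of the sets
   where F exceeds k. *)
Lemma ae_le_of_upper_integral d d' (T : measurableType d) (T' : measurableType d')
    (P : probability T R) (phi : T -> T') (mphi : measurable_fun setT phi)
    (F k : T' -> \bar R) :
  measurable_fun setT k -> (forall x, 0 <= k x) -> (forall x, 0 <= F x) ->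
  (forall A (mA : measurable A) (PA : 0 < P A),
    upper_integral (conditional_image mA PA mphi) F <=
    \int[conditional_image mA PA mphi]_x k x) ->
  {ae P, forall w, F (phi w) <= k (phi w)}.
Proof.
move=> mk k0 F0 H.
pose X n := [set w | k (phi w) <= n%:R%:E /\ k (phi w) + n.+1%:R^-1%:E <=
  F (phi w)].
suff X0 n : P.-negligible (X n).
  apply: (@negligibleS _ _ _ P (\bigcup_n X n)); last exact: negligible_bigcup.
  move=> w /= /negP; rewrite -ltNge => /(lte_witness (k0 _))[n nw].
  by exists n.
have [Y [mY XY YP]] := measurable_hull P (X n).
have mkphi : measurable_fun setT (k \o phi) by exact: measurableT_comp.
(* The hull may leave the region where [k] is bounded by [n]. Cutting it back keeps [X n] inside and
   makes the integral of [k] finite. *)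
pose A := Y `&` [set w | k (phi w) <= n%:R%:E].
have mA : measurable A.
  apply: measurableI => //; rewrite -[X in measurable X]setTI.
  by apply: measurable_lee.
have XA : X n `<=` A by move=> w Xw; split; [exact: XY|case: Xw].
have [PA|/negP] := boolP (0 < P A); last first.
  rewrite lt0e measure_ge0 andbT => /negP; rewrite negbK => /eqP PA.
  by exists A.
exfalso; have := H _ mA PA; set Q := conditional_image mA PA mphi.
have n1 : (0 < n.+1%:R^-1 :> R)%R by rewrite invr_gt0.
have QE B : P (phi @^-1` B `&` A) = 0 -> Q B = 0.
  by rewrite /Q conditional_imageE => ->; rewrite mule0.
have kfin : \int[Q]_x k x < +oo.
  apply: (@le_lt_trans _ _ (\int[Q]_x n%:R%:E)).
    apply: ae_ge0_le_integral => //.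
    exists (~` [set u | k u <= n%:R%:E]); split.
    - apply: measurableC; rewrite -[X in measurable X]setTI.
      by apply: measurable_lee.
    - apply: QE; rewrite (_ : _ `&` _ = set0) ?measure0//.
      by apply/seteqP; split=> // w [/= + [_ /=]].
    - by move=> u /= uk ku; apply: uk.
  by rewrite integral_cst// lte_mul_pinfty//
    (le_lt_trans (probability_le1 Q measurableT))// ltry.
apply/negP; rewrite -ltNge.
apply: (@lt_le_trans _ _ (\int[Q]_x k x + n.+1%:R^-1%:E)).
  by rewrite lteDl ?lte_fin// ge0_fin_numE// integral_ge0.
apply: le_ereal_inf_tmp => _ [k' [mk' Fk'] <-].
have k'0 u : 0 <= k' u by exact: le_trans (Fk' u).
have -> : \int[Q]_x k x + n.+1%:R^-1%:E = \int[Q]_x (k x + n.+1%:R^-1%:E).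
  rewrite ge0_integralD//.
  by rewrite integral_cst// [X in _ * X](_ : _ = 1) ?mule1//;
    exact: probability_setT.
apply: ae_ge0_le_integral => //.
- by move=> u _; rewrite adde_ge0// lee_fin ltW.
- exact: emeasurable_funD.
(* The preimage of this set under [phi] is measurable and contains [X n], hence almost all of the
   hull. So every measurable majorant of [F] exceeds [k] by the gap almost everywhere, and so does
   the upper integral. *)
have mZ : measurable [set u | k u + n.+1%:R^-1%:E <= k' u].
  rewrite -[X in measurable X]setTI; apply: measurable_lee => //.
  exact: emeasurable_funD.
exists (~` [set u | k u + n.+1%:R^-1%:E <= k' u]); split.
- exact: measurableC.
- apply: QE; have mZ' : measurable
    (phi @^-1` [set u | k u + n.+1%:R^-1%:E <= k' u]).
    by rewrite -[X in measurable X]setTI; exact: (mphi measurableT _ mZ).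
  apply/eqP; rewrite eq_le measure_ge0 andbT.
  rewrite -(YP _ mZ'); last by move=> w [_ /le_trans]; apply; exact: Fk'.
  apply: le_measure; rewrite ?inE.
  + by apply: measurableI => //; exact: measurableC.
  + exact: measurableD.
  + by move=> w [/= Zw [Yw _]].
- by move=> u /= uk ku; apply: uk.
Qed.

End upper_integrals.

Section subslopes_along_curves.
Local Open Scope ereal_scope.
Context {R : realType} (M : mm_spacetime R) (d : M -> M -> R).
Hypothesis hd : bounded_distance_inducing d.
Notation mu := (@lebesgue_measure R).

Lemma measurable_esub dX (X : measurableType dX) (f g : X -> \bar R) :
  measurable_fun setT f -> measurable_fun setT g ->
  measurable_fun setT (fun x => esub (f x) (g x)).
Proof.
move=> mf mg.
have mset (h : X -> \bar R) (c : \bar R) : measurable_fun setT h ->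
    measurable (h @^-1` [set c]).
  by move=> mh; rewrite -[X in measurable X]setTI; apply: mh => //;
    exact: emeasurable_set1.
pose A := (f @^-1` [set +oo] `&` g @^-1` [set +oo]) `|`
  (f @^-1` [set -oo] `&` g @^-1` [set -oo]).
have mA : measurable A.
  by apply: measurableU; apply: measurableI; exact: mset.
rewrite (_ : (fun x => _) = fun x => if x \in A then +oo else f x - g x).
  by apply: measurable_fun_if_mem => //; exact: emeasurable_funB.
apply/funext => x; case: ifPn => [|xA].
  by rewrite inE => -[[-> ->]|[-> ->]].
case fx: (f x) => [r| |]; case gx: (g x) => [q| |] //; exfalso.
- by move: xA; rewrite notin_setE; apply; left.
- by move: xA; rewrite notin_setE; apply; right.
Qed.

(** Each superlevel set of [f] at a rational height is Borel off a null set; the union of these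
    countably many null sets is [N]. *)
Lemma causal_borel_version (f : M -> \bar R) : causal_function f ->
  exists (f' : M -> \bar R) (N : set (borel M)),
    [/\ measurable N, mms_measure M N = 0,
        measurable_fun setT (f' : borel M -> \bar R) &
        forall x, ~ N x -> f x = f' x].
Proof.
move=> [mf _].
pose q n : R := if unpickle n is Some r then ratr (r : rat) else 0%R.
have cA n : exists AN : set (borel M) * set (borel M),
    [/\ measurable AN.1, measurable AN.2, mms_measure M AN.2 = 0 &
      forall x, ~ AN.2 x -> (q n)%:E < f x <-> AN.1 x].
  have [A mA [N0 [N [mN N0' subN]] AN]] := mf _ (emeasurable_itv `](q n)%:E,
    +oo[).
  exists (A, N); split => // x /= Nx; split=> [qx|Ax].
    have : (A `|` N0) x by rewrite AN /= in_itv/= qx.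
    by case=> // /subN.
  have : (A `|` N0) x by left.
  by rewrite AN /= in_itv/= andbT.
have [AN ANP] := choice cA.
pose N := \bigcup_n (AN n).2.
have mN : measurable N by apply: bigcupT_measurable => n; case: (ANP n).
(* The value [-oo] keeps [N] out of every superlevel set at a real height. *)
exists (fun x => if x \in N then -oo else f x), N; split => //.
- apply: (measure_negligible mN); apply: negligible_bigcup => n.
  by have [_ mn n0 _] := ANP n; apply/(negligibleP _ mn).
- apply: (measurability _ (ErealGenOInfty.measurableE R)) => //.
  move=> _ [_ [r ->] <-]; rewrite setTI.
  rewrite (_ : _ @^-1` _ = \bigcup_(n in [set n | (r <= q n)%R])
    ((AN n).1 `\` N)).
    apply: bigcup_measurable => n _; apply: measurableD => //.
    by case: (ANP n).
  apply/seteqP; split=> x.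
    rewrite /= in_itv/= andbT; case: ifPn => // xN rx.
    have {}xN : ~ N x by move=> Nx; move: xN; rewrite mem_set.
    have [n rq qx] : exists2 n, (r <= q n)%R & (q n)%:E < f x.
      move: rx; case: (f x) => [y| |]//.
        rewrite lte_fin => /rat_in_itvoo[p]; rewrite in_itv/= => /andP[rp py].
        by exists (pickle p); rewrite /q pickleK ?lte_fin// ltW.
      have /rat_in_itvoo[p] : (r < r + 1)%R by lra.
      rewrite in_itv/= => /andP[rp _] _.
      by exists (pickle p); rewrite /q pickleK ?ltry// ltW.
    exists n => //; split => //.
    have [_ _ _ /(_ x) H] := ANP n; apply/H => // Nx; apply: xN; by exists n.
  move=> [n /= rq [Ax Nx]]; rewrite in_itv/= andbT memNset//.
  have [_ _ _ /(_ x) H] := ANP n.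
  apply: (@le_lt_trans _ _ (q n)%:E); first by rewrite lee_fin.
  by apply/H => // Nx'; apply: Nx; exists n.
- by move=> x Nx; rewrite memNset.
Qed.

Lemma test_plan_null (pi : probability (borel_lcc d) R) (N : set (borel M))
    (t : R) :
  test_plan pi -> measurable N -> mms_measure M N = 0 -> (0 <= t <= 1)%R ->
  pi [set g | N ((g : lcc M) t)] = 0.
Proof.
move=> [C C0 piC] mN N0 /andP[t0 t1]; apply/eqP; rewrite eq_le measure_ge0 andbT.
have := piC t t0 t1 N mN; rewrite N0 mule0; exact.
Qed.

(** The marginal at [r] is a conditioned marginal of [pi] at [affine s t r]; conditioning multiplies
    the density bound by at most the inverse of [pi A]. *)
Lemma test_plan_restrict (pi : probability (borel_lcc d) R)
    (A : set (borel_lcc d)) (mA : measurable A) (piA : 0 < pi A) (s t : R)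
    (st : [/\ (0 <= s)%R, (s < t)%R & (t <= 1)%R]) : test_plan pi ->
  test_plan (conditional_image mA piA (measurable_lcc_restrict hd st)).
Proof.
move=> [C C0 piC]; have [s0 slt t1] := st.
have pA0 : (0 < fine (pi A))%R by rewrite -lte_fin fineK// fin_num_measure.
exists ((fine (pi A))^-1 * C)%R; first by rewrite mulr_gt0// invr_gt0.
move=> r r0 r1 B mB; rewrite /pushforward [leLHS]conditional_imageE EFinM -muleA.
rewrite lee_pmul2l// ?lte_fin ?invr_gt0//.
have r01 : (0 <= r <= 1)%R by rewrite r0.
have /andP[sr rt] := affine_itv slt r01.
apply: le_trans (piC (affine s t r) _ _ B mB); [|lra|lra].
have mB' : measurable ((fun g : borel_lcc d => (g : lcc M) (affine s t r) :
  borel M) @^-1` B).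
  by rewrite -[X in measurable X]setTI; apply: measurable_eval.
apply: le_measure; rewrite ?inE//.
  apply: measurableI => //.
  rewrite (_ : _ @^-1` _ = (fun g : borel_lcc d => (g : lcc M) (affine s t r) :
    borel M) @^-1` B)//.
  by apply/seteqP; split=> g /=; rewrite -(lcc_restrictE g st r01).
by move=> g [+ _] /=; rewrite -(lcc_restrictE g st r01).
Qed.

Lemma causal_function_curve (f : M -> \bar R) (g : lcc M) (x y : R) :
  causal_function f -> (0 <= x)%R -> (x <= y)%R -> (y <= 1)%R -> f (g x) <=
    f (g y).
Proof. by move=> [_ cf] x0 xy y1; apply: cf; exact: lcc_causal. Qed.

End subslopes_along_curves.

(** * Pathwise inequalities and the gluing of subslopes *)

Section slope_locality.
Local Open Scope ereal_scope.
Context {R : realType} (M : mm_spacetime R) (d : M -> M -> R).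
Hypothesis hd : bounded_distance_inducing d.
Notation mu := (@lebesgue_measure R).
Implicit Types (f G : M -> \bar R) (g : lcc M).

Definition speed_integral G g : \bar R :=
  \int[mu]_(t in `[0%R, 1%R]) (G (g t) * causal_speed g t).

Lemma speed_integral_ge0 G g : (forall x, 0 <= G x) -> 0 <= speed_integral G g.
Proof.
by move=> G0; apply: integral_ge0 => t _; rewrite mule_ge0// causal_speed_ge0.
Qed.

(** With [f'] a Borel version of a causal [f] off [N], [c = +oo] yields a measurable majorant of the
    increment of [f], and [c = 0] a measurable minorant since that increment is nonnegative. *)
Lemma measurable_off_null f' (N : set (borel M)) (c : \bar R) :
  measurable N -> measurable_fun setT (f' : borel M -> \bar R) ->
  let bad := [set g : borel_lcc d | N ((g : lcc M) 1%R) \/ N ((g : lcc M) 0%R)] in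
  measurable bad /\ measurable_fun setT
    (fun g : borel_lcc d => if g \in bad then c
    else esub (f' ((g : lcc M) 1%R)) (f' ((g : lcc M) 0%R))).
Proof.
move=> mN mf' bad.
have mev t : measurable [set g : borel_lcc d | N ((g : lcc M) t)].
  by rewrite -[X in measurable X]setTI;
    exact: (measurable_eval hd t measurableT mN).
have mbad : measurable bad.
  rewrite (_ : bad = [set g : borel_lcc d | N ((g : lcc M) 1%R)] `|`
    [set g : borel_lcc d | N ((g : lcc M) 0%R)])//.
  exact: measurableU.
split => //; apply: measurable_fun_if_mem => //.
by apply: measurable_esub; apply: (measurableT_comp mf'); exact: measurable_eval.
Qed.

(** The conditioned restrictions of [pi] are test plans, so [ae_le_of_upper_integral] bounds the
    speed integral by the majorant [k]. Marginals of [pi] do not charge [N], so [k] is almost surely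
    the true increment. *)
Lemma subslope_ae_restrict f G (pi : probability (borel_lcc d) R) (s t : R)
    (st : [/\ (0 <= s)%R, (s < t)%R & (t <= 1)%R]) :
  causal_function f -> weak_subslope d f G -> test_plan pi ->
  {ae pi, forall g : borel_lcc d,
    speed_integral G (lcc_restrict (g : lcc M) st) <=
    esub (f ((g : lcc M) t)) (f ((g : lcc M) s))}.
Proof.
move=> cf [mG G0 fG] tpi; have [s0 slt t1] := st.
have [f' [N [mN N0 mf' ff']]] := causal_borel_version cf.
have [mbad mk] := measurable_off_null +oo mN mf'.
set bad := [set g : borel_lcc d | _] in mbad mk;
  set k := (X in measurable_fun _ X) in mk.
have I0 : (0 <= (0 : R) <= 1)%R by rewrite lexx ler01.
have I1 : (0 <= (1 : R) <= 1)%R by rewrite lexx ler01.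
have esub0 (g : lcc M) : 0 <= esub (f (g 1%R)) (f (g 0%R)).
  by apply: esub_ge0; apply: causal_function_curve.
have esubk (g : borel_lcc d) :
  esub (f ((g : lcc M) 1%R)) (f ((g : lcc M) 0%R)) <= k g.
  rewrite /k; case: ifPn => [_|]; first exact: leey.
  by rewrite notin_setE => /not_orP[n1 n0]; rewrite !ff'.
have k0 g : 0 <= k g by exact: le_trans (esubk g).
have H := @ae_le_of_upper_integral _ _ _ _ _ pi _ (measurable_lcc_restrict hd st)
  (speed_integral G) k mk k0 (fun g => speed_integral_ge0 g G0).
have {}H : {ae pi, forall w : borel_lcc d,
    speed_integral G (lcc_restrict (w : lcc M) st) <=
      k (lcc_restrict (w : lcc M) st)}.
  apply: H => A mA PA; apply: le_trans
    (fG _ (test_plan_restrict hd mA PA st tpi)) _.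
  by apply: ge0_le_lower_integral.
have Hn (u : R) : (0 <= u <= 1)%R ->
  {ae pi, forall g : borel_lcc d, ~ N ((g : lcc M) u)}.
  move=> u01; exists [set g | N ((g : lcc M) u)]; split.
  - by rewrite -[X in measurable X]setTI;
      exact: (measurable_eval hd u measurableT mN).
  - exact: test_plan_null.
  - by move=> g /= /contrapT.
have FF : Filter (nbhs (almost_everywhere pi)).
  exact: ae_filter_ringOfSetsType.
have Hs : {ae pi, forall g : borel_lcc d, ~ N ((g : lcc M) s)} by apply: Hn;
  apply/andP; split; lra.
have Ht : {ae pi, forall g : borel_lcc d, ~ N ((g : lcc M) t)} by apply: Hn;
  apply/andP; split; lra.
apply: filterS3 H Hs Ht => g Hg gs gt; apply: le_trans Hg _.
have e1 : lcc_restrict (g : lcc M) st 1%R = (g : lcc M) t.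
  by rewrite (lcc_restrictE g st I1) affine1.
have e0 : lcc_restrict (g : lcc M) st 0%R = (g : lcc M) s.
  by rewrite (lcc_restrictE g st I0) affine0.
rewrite /k e1 e0 -!ff'// memNset// => -[]; first by rewrite e1.
by rewrite e0.
Qed.

(** Pairs of rationals are countable, so one null set of curves serves them all. Existence of the
    causal speed on [g] identifies the speed integral of a restriction with the integral over
    [[a, b]]. *)
Lemma subslope_ae f G (pi : probability (borel_lcc d) R) :
  causal_function f -> weak_subslope d f G -> test_plan pi ->
  {ae pi, forall g : borel_lcc d,
    is_causal_speed (g : lcc M) (causal_speed (g : lcc M)) ->
    forall a b : rat, (0 <= (ratr a : R))%R -> ((ratr a : R) < ratr b)%R ->
    ((ratr b : R) <= 1)%R ->
    \int[mu]_(r in `[ratr a, ratr b])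
      (G ((g : lcc M) r) * causal_speed (g : lcc M) r) <=
    esub (f ((g : lcc M) (ratr b))) (f ((g : lcc M) (ratr a)))}.
Proof.
move=> cf fG tpi; have [mG G0 _] := fG.
pose Q (ab : rat * rat) (g : lcc M) := is_causal_speed g (causal_speed g) ->
  (0 <= (ratr ab.1 : R))%R -> ((ratr ab.1 : R) < ratr ab.2)%R ->
    ((ratr ab.2 : R) <= 1)%R ->
  \int[mu]_(r in `[ratr ab.1, ratr ab.2]) (G (g r) * causal_speed g r) <=
    esub (f (g (ratr ab.2))) (f (g (ratr ab.1))).
have H n : {ae pi, forall g : borel_lcc d, Q (odflt (0, 0)%R (unpickle n)) g}.
  case: (odflt _ _) => a b; rewrite /Q /=.
  have [st|st] := pselect [/\ (0 <= (ratr a : R))%R,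
    ((ratr a : R) < ratr b)%R & ((ratr b : R) <= 1)%R].
    have := subslope_ae_restrict st cf fG tpi; apply: filterS => g Hg gv a0 ab b1.
    by rewrite -(integral_causal_speed_restrict st).
  by apply: aeW => g gv a0 ab b1; exfalso; apply: st.
have {}H := ae_foralln H.
move: H; apply: filterS => g Hg gv a b a0 ab b1.
by have := Hg (pickle (a, b)); rewrite pickleK /Q /=; apply.
Qed.

(** The upper integral calls for a measurable majorant [k'] of the speed integral, the other side
    for a measurable minorant [k] of the increment; the two differ only on a null set of curves,
    where [k'] is [+oo]. *)
Lemma subslope_of_ae f G : causal_function f ->
  measurable_fun setT (G : borel M -> \bar R) -> (forall x, 0 <= G x) ->
  (forall pi : probability (borel_lcc d) R, test_plan pi ->
    {ae pi, forall g : borel_lcc d, speed_integral G (g : lcc M) <=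
      esub (f ((g : lcc M) 1%R)) (f ((g : lcc M) 0%R))}) ->
  weak_subslope d f G.
Proof.
move=> cf mG G0 H; split => // pi tpi.
have [f' [N [mN N0 mf' ff']]] := causal_borel_version cf.
have [mbad mk] := measurable_off_null 0 mN mf'.
set bad := [set g : borel_lcc d | _] in mbad mk;
  set k := (X in measurable_fun _ X) in mk.
have esub0 (g : lcc M) : 0 <= esub (f (g 1%R)) (f (g 0%R)).
  by apply: esub_ge0; apply: causal_function_curve.
have esubk (g : borel_lcc d) : k g <=
  esub (f ((g : lcc M) 1%R)) (f ((g : lcc M) 0%R)).
  rewrite /k; case: ifPn => [_ //|].
  by rewrite notin_setE => /not_orP[n1 n0]; rewrite -!ff'.
have k0 g : 0 <= k g.
  rewrite /k; case: ifPn => [//|].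
  by rewrite notin_setE => /not_orP[n1 n0]; rewrite -!ff'.
have [Z [mZ Z0 HZ]] := H pi tpi.
have bad0 : pi bad = 0.
  have n01 u : (0 <= u <= 1)%R ->
    pi.-negligible [set g : borel_lcc d | N ((g : lcc M) u)].
    move=> u01; exists [set g : borel_lcc d | N ((g : lcc M) u)]; split => //.
    - by rewrite -[X in measurable X]setTI;
        exact: (measurable_eval hd u measurableT mN).
    - exact: test_plan_null.
  apply: (measure_negligible mbad).
  by apply: negligibleU; apply: n01; rewrite lexx ler01.
pose k' (g : borel_lcc d) := if g \in bad `|` Z then +oo else k g.
have mk' : measurable_fun setT k'.
  by apply: measurable_fun_if_mem => //; exact: measurableU.
have k'0 g : 0 <= k' g by rewrite /k'; case: ifP.
apply: (@le_trans _ _ (\int[pi]_g k' g)).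
  apply: ereal_inf_lbound; exists k' => //; split => // g.
  rewrite /k'; case: ifPn => [_|]; first exact: leey.
  rewrite notin_setE => /not_orP[gb gZ].
  rewrite /k memNset// -!ff';
    [|by move=> n; apply: gb; right|by move=> n; apply: gb; left].
  by apply: contrapT => gh; apply: gZ; apply: HZ.
apply: (@le_trans _ _ (\int[pi]_g k g)); last exact: ge0_le_lower_integral.
apply: ae_ge0_le_integral => //.
have mbZ : measurable (bad `|` Z) by exact: measurableU.
exists (bad `|` Z); split => //.
  apply/eqP; rewrite eq_le measure_ge0 andbT (le_trans (measureU2 _ mbad mZ))//.
  by rewrite [X in X + _ <= _](_ : _ = 0) ?[X in _ + X <= _](_ : _ = 0) ?adde0.
move=> g /= kg; apply: contrapT => gbZ; apply: kg => _.
by rewrite /k' memNset.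
Qed.

Lemma speed_integral_eq0 G g : causal_speed g = cst 0 -> speed_integral G g = 0.
Proof.
move=> v0; rewrite /speed_integral v0 (eq_integral (cst 0)) ?integral0//.
by move=> t _; rewrite mule0.
Qed.

(** On almost every curve having a causal speed, [integral_locality] applies with [B] the set of
    times spent in [A]. *)
Lemma locality_ae f1 f2 G1 G2 (E : set (measurableTypeR R)) (A : set (borel M))
    (pi : probability (borel_lcc d) R) :
  causal_function f1 -> causal_function f2 ->
  weak_subslope d f1 G1 -> weak_subslope d f2 G2 ->
  mu E = 0 -> measurable A ->
  (forall x, A x -> (EFin @` E) (esub (f1 x) (f2 x))) -> test_plan pi ->
  {ae pi, forall g : borel_lcc d,
    speed_integral (fun x => if x \in A then G1 x else G2 x) (g : lcc M) <=
      esub (f2 ((g : lcc M) 1%R)) (f2 ((g : lcc M) 0%R))}.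
Proof.
move=> cf1 cf2 fG1 fG2 E0 mA AE tpi.
have [mG1 G10 _] := fG1; have [mG2 G20 _] := fG2.
have FF : Filter (nbhs (almost_everywhere pi)).
  exact: ae_filter_ringOfSetsType.
apply: filterS2 (subslope_ae cf1 fG1 tpi) (subslope_ae cf2 fG2 tpi) => g H1 H2.
have [gv|v0] := causal_speedP g; last first.
  rewrite speed_integral_eq0//; apply: esub_ge0.
  exact: causal_function_curve.
pose B : set R := [set t | A ((g : lcc M) t)].
have mB : measurable B.
  by rewrite -[X in measurable X]setTI;
    exact: (measurable_lcc (g : lcc M) measurableT mA).
rewrite /speed_integral.
rewrite (_ : integral _ _ _ = \int[mu]_(t in `[0%R, 1%R])
  (if t \in B then G1 ((g : lcc M) t) * causal_speed (g : lcc M) t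
   else G2 ((g : lcc M) t) * causal_speed (g : lcc M) t)); last first.
  apply: eq_integral => t _; have [At|At] := pselect (A ((g : lcc M) t)).
    by rewrite !mem_set.
  by rewrite !memNset.
have mw G : measurable_fun setT (G : borel M -> \bar R) ->
    measurable_fun setT (fun t : R =>
      G ((g : lcc M) t) * causal_speed (g : lcc M) t).
  move=> mG; apply: emeasurable_funM; last exact: measurable_causal_speed.
  exact: measurable_comp_lcc.
apply: (@integral_locality _ (f1 \o (g : lcc M)) (f2 \o (g : lcc M)) _ _ B E)
  => //.
- by move=> x y x0 xy y1; exact: causal_function_curve.
- by move=> x y x0 xy y1; exact: causal_function_curve.
- exact: mw.
- by move=> t; rewrite mule_ge0// causal_speed_ge0.
- exact: mw.
- by move=> t; rewrite mule_ge0// causal_speed_ge0.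
- exact: H1.
- exact: H2.
- by move=> t Bt; exact: AE.
Qed.

Lemma locality_subslope f1 f2 G1 G2 (E : set (measurableTypeR R))
    (A : set (borel M)) :
  causal_function f1 -> causal_function f2 ->
  weak_subslope d f1 G1 -> weak_subslope d f2 G2 ->
  mu E = 0 -> measurable A ->
  (forall x, A x -> (EFin @` E) (esub (f1 x) (f2 x))) ->
  weak_subslope d f2 (fun x => if x \in A then G1 x else G2 x).
Proof.
move=> cf1 cf2 fG1 fG2 E0 mA AE.
have [mG1 G10 _] := fG1; have [mG2 G20 _] := fG2.
apply: subslope_of_ae => //.
- exact: measurable_fun_if_mem.
- by move=> x; case: ifP.
- by move=> pi tpi; exact: (locality_ae cf1 cf2 fG1 fG2 E0 mA AE tpi).
Qed.

(** If [f] is [+oo] at the end of the curve or [-oo] at its start, the increment is [+oo]. Otherwise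
    monotonicity keeps [f] finite along the curve, which then never meets [A]. *)
Lemma infinite_subslope f G (A : set (borel M)) :
  causal_function f -> weak_subslope d f G -> measurable A ->
  (forall x, A x -> f x \isn't a fin_num) ->
  weak_subslope d f (fun x => if x \in A then +oo else G x).
Proof.
move=> cf fG mA AE; have [mG G0 _] := fG.
apply: subslope_of_ae => //.
- exact: measurable_fun_if_mem.
- by move=> x; case: ifP.
move=> pi tpi; have := subslope_ae cf fG tpi; apply: filterS => g Hg.
have fg0 : 0 <= esub (f ((g : lcc M) 1%R)) (f ((g : lcc M) 0%R)).
  by apply: esub_ge0; exact: causal_function_curve.
have [gv|v0] := causal_speedP g; last by rewrite speed_integral_eq0.
have [->|f1] := eqVneq (f ((g : lcc M) 1%R)) +oo.
  by case: (f ((g : lcc M) 0%R)) => *; rewrite leey.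
have [->|f0] := eqVneq (f ((g : lcc M) 0%R)) -oo.
  by case: (f ((g : lcc M) 1%R)) => *; rewrite leey.
have ffin t : (0 <= t <= 1)%R -> f ((g : lcc M) t) \is a fin_num.
  move=> /andP[t0 t1]; rewrite fin_numE; apply/andP; split.
    apply: contra f0 => /eqP tE; rewrite -leeNy_eq -tE.
    exact: causal_function_curve.
  apply: contra f1 => /eqP tE; rewrite -leye_eq -tE.
  exact: causal_function_curve.
have := Hg gv 0%R 1%R; rewrite rmorph0 rmorph1 => /(_ (lexx _) ltr01 (lexx _)).
apply: le_trans; rewrite le_eqVlt; apply/orP; left; apply/eqP.
apply: eq_integral => t; rewrite inE => t01'.
have t01 : (0 <= t <= 1)%R by move: t01'; rewrite /= in_itv.
by rewrite memNset// => /AE; rewrite ffin.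
Qed.

End slope_locality.

(** * Locality of the slope *)

Section slopes.
Local Open Scope ereal_scope.
Context {R : realType} (M : mm_spacetime R) (d : M -> M -> R).
Hypothesis hd : bounded_distance_inducing d.
Notation mu := (@lebesgue_measure R).
Notation m := (mms_measure M).

Lemma ae_not_null (N : set (borel M)) : measurable N -> m N = 0 ->
  {ae m, forall x, ~ N x}.
Proof. by move=> mN N0; exists N; split => // x /= /contrapT. Qed.

Lemma slope_le (f1 f2 df1 df2 : M -> \bar R) (E : set (measurableTypeR R))
    (A : set (borel M)) :
  causal_function f1 -> causal_function f2 ->
  is_slope d f1 df1 -> is_slope d f2 df2 -> mu E = 0 -> measurable A ->
  (forall x, A x -> (EFin @` E) (esub (f1 x) (f2 x))) ->
  {ae m, forall x, A x -> df1 x <= df2 x}.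
Proof.
move=> cf1 cf2 [sf1 _] [sf2 maxf2] E0 mA AE.
have FF : Filter (nbhs (almost_everywhere m)) by exact: ae_filter_ringOfSetsType.
have := maxf2 _ (locality_subslope hd cf1 cf2 sf1 sf2 E0 mA AE).
by apply: filterS => x + Ax; rewrite mem_set.
Qed.

Lemma slope_eq (f1 f2 df1 df2 : M -> \bar R) (E : set (measurableTypeR R)) :
  causal_function f1 -> causal_function f2 ->
  is_slope d f1 df1 -> is_slope d f2 df2 -> measurable E -> mu E = 0 ->
  {ae m, forall x, (EFin @` E) (esub (f1 x) (f2 x)) -> df1 x = df2 x}.
Proof.
move=> cf1 cf2 sf1 sf2 mE E0.
have [f1' [N1 [mN1 N10 mf1' ff1']]] := causal_borel_version cf1.
have [f2' [N2 [mN2 N20 mf2' ff2']]] := causal_borel_version cf2.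
pose A : set (borel M) :=
  [set x | (EFin @` E) (esub (f1' x) (f2' x))] `\` (N1 `|` N2).
have mA : measurable A.
  apply: measurableD; last exact: measurableU.
  rewrite -[X in measurable X]setTI; apply: (measurable_esub mf1' mf2') => //.
  exact: measurable_image_EFin.
have AE x : A x -> (EFin @` E) (esub (f1 x) (f2 x)).
  by move=> [Ex /not_orP[n1 n2]]; rewrite ff1'// ff2'.
(* Exchanging [f1] and [f2] reflects [E], which remains null; this yields the opposite
   inequality. *)
pose E' : set (measurableTypeR R) := -%R @^-1` E.
have E'0 : mu E' = 0 by rewrite -E0; exact: lebesgue_measureN.
have AE' x : A x -> (EFin @` E') (esub (f2 x) (f1 x)).
  move=> /AE[r Er]; rewrite /E'; case: (f1 x) (f2 x) => [a| |] [b| |]//= [ra].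
  by exists (b - a)%R => //=; rewrite opprB -ra.
have FF : Filter (nbhs (almost_everywhere m)) by exact: ae_filter_ringOfSetsType.
apply: filterS2 (filterI (slope_le cf1 cf2 sf1 sf2 E0 mA AE)
  (slope_le cf2 cf1 sf2 sf1 E'0 mA AE'))
    (filterI (ae_not_null mN1 N10) (ae_not_null mN2 N20)).
move=> x [le12 le21] [n1 n2] Ex.
have Ax : A x by split; [rewrite /= -ff1'// -ff2'|case].
by apply/eqP; rewrite eq_le le12// le21.
Qed.

(** Maximality of [df] against the subslope raised to [+oo] on a Borel version of the set where [f]
    is infinite. *)
Lemma slope_infinite (f df : M -> \bar R) :
  causal_function f -> is_slope d f df ->
  {ae m, forall x, f x \isn't a fin_num -> df x = +oo}.
Proof.
move=> cf [sf maxf].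
have [f' [N [mN N0 mf' ff']]] := causal_borel_version cf.
pose A : set (borel M) := (f' @^-1` [set +oo] `|` f' @^-1` [set -oo]) `\` N.
have mset c : measurable (f' @^-1` [set c] : set (borel M)).
  by rewrite -[X in measurable X]setTI; apply: mf' => //; exact: emeasurable_set1.
have mA : measurable A.
  by apply: measurableD => //; apply: measurableU; exact: mset.
have AE x : A x -> f x \isn't a fin_num.
  by move=> [fx Nx]; rewrite ff'//; case: fx => /= ->.
have FF : Filter (nbhs (almost_everywhere m)) by exact: ae_filter_ringOfSetsType.
apply: filterS2 (maxf _ (infinite_subslope hd cf sf mA AE)) (ae_not_null mN N0).
move=> x + Nx fx; rewrite mem_set; first by rewrite leye_eq => /eqP.
split => //; move: fx; rewrite /= ff'//.
by case: (f' x) => [r| |]//= _; [left|right].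
Qed.

Lemma upper_integral_ae0 dT (T : measurableType dT)
    (P : {measure set T -> \bar R})
    (h : T -> \bar R) : {ae P, forall x, h x = 0} -> upper_integral P h <= 0.
Proof.
move=> [Z [mZ Z0 hZ]].
pose k x : \bar R := if x \in Z then +oo else 0.
have mk : measurable_fun setT k by exact: measurable_fun_if_mem.
have -> : 0 = \int[P]_x k x.
  rewrite -(integral0 P setT); apply: ge0_ae_eq_integral => //.
    by move=> x _; rewrite /k; case: ifP.
  exists Z; split => // x /= kx; apply: contrapT => Zx; apply: kx => _.
  by rewrite /k memNset.
apply: ereal_inf_lbound; exists k => //; split => // x.
rewrite /k; case: ifPn => [_|]; first exact: leey.
by rewrite notin_setE => Zx; rewrite le_eqVlt; apply/orP; left; apply/eqP;
  apply: contrapT => hx; apply: Zx; exact: hZ.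
Qed.

Lemma causal_function_cst0 : causal_function (cst 0 : M -> \bar R).
Proof.
split=> [B mB|x y _]; last exact: lexx.
exists ((cst 0 : borel M -> \bar R) @^-1` B).
  rewrite -[X in measurable X]setTI.
  exact: (@measurable_cst _ _ (borel M) (\bar R) setT 0 measurableT B mB).
by exists set0; [exact: negligible_set0|rewrite setU0].
Qed.

Lemma weak_subslope_cst0 : weak_subslope d (cst 0) (cst 0 : M -> \bar R).
Proof.
apply: (subslope_of_ae hd) => //; first exact: causal_function_cst0.
move=> pi _; apply: aeW => g /=; rewrite /speed_integral.
under eq_integral do rewrite mul0e.
by rewrite integral0 oppr0 adde0.
Qed.

(* Comparing f with 0 gives 1_A(g_t) |df|(g_t) |g'_t| = 0 for almost every t. *)
Lemma speed_pushforward_level_set (f df : M -> \bar R)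
    (E : set (measurableTypeR R))
    (A : set (borel M)) (pi : probability (borel_lcc d) R) :
  causal_function f -> is_slope d f df -> mu E = 0 -> measurable A ->
  (forall x, A x -> (EFin @` E) (f x) /\ 0 < df x) -> test_plan pi ->
  speed_pushforward pi A <= 0.
Proof.
move=> cf [sf _] E0 mA AE tpi; apply: upper_integral_ae0.
have AE' x : A x -> (EFin @` E) (esub (f x) (cst 0 x)).
  by move=> /AE[[r Er fx] _]; exists r => //; rewrite -fx /= oppr0 adde0.
have := locality_ae hd cf causal_function_cst0 sf weak_subslope_cst0 E0 mA AE'
  tpi.
have FF : Filter (nbhs (almost_everywhere pi)).
  exact: ae_filter_ringOfSetsType.
have [mdf df0 _] := sf.
apply: filterS => g; rewrite [X in _ <= X]esub_fin subrr /speed_integral.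
set w := (X in integral _ _ X) => w_le.
have w0 t : 0 <= w t.
  by rewrite /w mule_ge0 ?causal_speed_ge0//; case: ifP.
have mw : measurable_fun setT w.
  apply: emeasurable_funM; last exact: measurable_causal_speed.
  apply: (@measurable_comp_lcc _ _ (fun x => if x \in A then df x else cst 0 x)).
  exact: measurable_fun_if_mem.
have m01 : measurable (`[0%R, 1%R]%classic : set (measurableTypeR R)).
  exact: measurable_itv.
have w_ae : ae_eq mu `[0%R, 1%R]%classic w (cst 0).
  apply/ae_eq_integral_abs => //; first exact: measurable_funTS.
  under eq_integral do rewrite gee0_abs//.
  by apply/eqP; rewrite eq_le w_le integral_ge0.
rewrite -(integral0 mu `[0%R, 1%R]%classic); apply: ge0_ae_eq_integral => //.
- apply: measurable_funTS; apply: emeasurable_funM;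
    last exact: measurable_causal_speed.
  apply: (@measurable_comp_lcc _ _ (fun x => (\1_A x)%:E)).
  by apply/measurable_EFinP; exact: measurable_indic.
- by move=> t _; rewrite mule_ge0 ?causal_speed_ge0// lee_fin.
have FF' : Filter (nbhs (almost_everywhere mu)).
  exact: ae_filter_ringOfSetsType.
apply: filterS w_ae => t wt t01; have := wt t01; rewrite /w indicE /=.
have [At|At] := boolP ((g : lcc M) t \in A); last by rewrite mul0e.
(* [df] is positive on [A], so in the vanishing product it is the speed that is 0. *)
have [_ dfx] := AE _ (set_mem At).
by move=> /eqP; rewrite mule_eq0 gt_eqF//= => /eqP ->; rewrite mule0.
Qed.

(** No speed density charges [A], the set where the conclusion fails up to a null set. Hence the
    complement of [A] in [V] still contains all speed densities, and minimality of [V] makes the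
    intersection of [V] and [A] null. *)
Lemma slope_eq0_on_vis (f df : M -> \bar R) (E : set (measurableTypeR R))
    (V : set M) :
  causal_function f -> is_slope d f df -> measurable E -> mu E = 0 ->
  is_vis d V -> {ae m, forall x, (EFin @` E) (f x) -> V x -> df x = 0}.
Proof.
move=> cf sf mE E0 [mV Vd Vmin]; have [[mdf df0 _] _] := sf.
have [f' [N [mN N0 mf' ff']]] := causal_borel_version cf.
have mpos (r : M -> \bar R) : measurable_fun setT (r : borel M -> \bar R) ->
    measurable ([set x | 0 < r x] : set (borel M)).
  by move=> mr; rewrite -[X in measurable X]setTI; apply: measurable_lte.
pose A : set (borel M) :=
  [set x | (EFin @` E) (f' x)] `&` [set x | 0 < df x] `\` N.
have mA : measurable A.
  apply: measurableD => //; apply: measurableI; last exact: mpos.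
  by rewrite -[X in measurable X]setTI; apply: mf' => //;
    exact: measurable_image_EFin.
have AE x : A x -> (EFin @` E) (f x) /\ 0 < df x.
  by move=> [[Ex dfx] Nx]; rewrite ff'.
have mW : measurable (V `\` A : set (borel M)) by exact: measurableD.
have VA : m (V `\` (V `\` A)) = 0.
  apply: Vmin => // pi tpi rho rhoP; have [mrho rho0 rhoE] := rhoP.
  have rhoA : \int[m]_(x in A) rho x = 0.
    apply/eqP; rewrite eq_le integral_ge0// andbT -rhoE//.
    exact: (speed_pushforward_level_set cf sf E0 mA AE).
  have ae0 : ae_eq m A rho (cst 0).
    apply/ae_eq_integral_abs => //; first exact: measurable_funTS.
    by under eq_integral do rewrite gee0_abs//.
  have nA : m.-negligible ([set x | 0 < rho x] `&` A).
    by apply: negligibleS ae0 => x [/= rx Ax] /(_ Ax) r0; move: rx;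
      rewrite r0 ltxx.
  have nV : m.-negligible ([set x | 0 < rho x] `\` V).
    apply/negligibleP; last exact: (Vd pi tpi rho rhoP).
    by apply: measurableD => //; exact: mpos.
  apply: (measure_negligible _ _).
    by apply: measurableD => //; exact: mpos.
  apply: negligibleS (negligibleU nV nA) => x [/= rx nVA].
  have [Vx|Vx] := pselect (V x); last by left.
  by right; split => //; apply: contrapT => Ax; apply: nVA.
have aeVA : {ae m, forall x, ~ (V `&` A) x}.
  exists (V `\` (V `\` A)); split => //; first exact: measurableD.
  by move=> x /= /contrapT[Vx Ax]; split => // -[].
have FF : Filter (nbhs (almost_everywhere m)) by exact: ae_filter_ringOfSetsType.
apply: filterS2 aeVA (ae_not_null mN N0) => x nVA Nx Ex Vx.
apply/eqP/negPn/negP => dfx; apply: nVA; split => //; split => //; split.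
  by rewrite /= -ff'.
by rewrite /= lt0e dfx df0.
Qed.

End slopes.

Local Open Scope ereal_scope.

Theorem proposition3p22 (R : realType) (M : mm_spacetime R)
    (d : M -> M -> R) (hd : bounded_distance_inducing d)
    (f1 f2 : M -> \bar R) (hf1 : causal_function f1) (hf2 : causal_function f2)
    (df1 df2 : M -> \bar R) (hdf1 : is_slope d f1 df1) (hdf2 : is_slope d f2 df2)
    (E : set (measurableTypeR R)) (mE : measurable E)
    (E0 : lebesgue_measure E = 0) :
  [/\ {ae mms_measure M, forall x,
         (EFin @` E) (esub (f1 x) (f2 x)) -> df1 x = df2 x},
      {ae mms_measure M, forall x, f1 x = f2 x -> df1 x = df2 x} &
      forall V : set M, is_vis d V ->
        {ae mms_measure M, forall x,
           (EFin @` E) (f1 x) -> V x -> df1 x = 0}].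
Proof.
split.
- exact: (slope_eq hd hf1 hf2 hdf1 hdf2 mE E0).
- have FF : Filter (nbhs (almost_everywhere (mms_measure M))).
    exact: ae_filter_ringOfSetsType.
  have m0 : measurable ([set 0%R] : set (measurableTypeR R)) by exact: measurable_set1.
  have n0 : lebesgue_measure ([set 0%R] : set (measurableTypeR R)) = 0.
    exact: lebesgue_measure_set1.
  (* The null set is now [{0}]. It covers finite common values only: at infinite ones [esub] is
     [+oo], and both slopes equal [+oo]. *)
  apply: filterS3 (slope_eq hd hf1 hf2 hdf1 hdf2 m0 n0) (slope_infinite hd hf1 hdf1)
    (slope_infinite hd hf2 hdf2) => x H1 H2 H3 f12.
  have [f1fin|f1inf] := boolP (f1 x \is a fin_num); last by rewrite H2// H3// -f12.
  apply: H1; rewrite -f12; exists 0%R => //.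
  by case: (f1 x) f1fin => // r _; rewrite esub_fin subrr.
- by move=> V; exact: (slope_eq0_on_vis hd hf1 hdf1 mE E0).
Qed.
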